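(* Let $A$ be a $C^{*}$-subalgebra of $\mathcal{F}_{n}$ such that the relative commutant $A'\cap \mathcal{F}_{n}$ is finite-dimensional. Consider the two subgroups of the automorphism group $\mathrm{Aut}(A)$ $$G=\{\mathrm{Ad}U|_{A}\ :\ U\in \mathcal{N}_{\mathcal{O}_{n}}(A)\},\qquad H=\{\mathrm{Ad}u|_{A}\ :\ u\in \mathcal{N}_{\mathcal{F}_{n}}(A)\}.$$ Then $H$ is a subgroup of $G$ with finite index.
   Context: $\mathcal{O}_{n}$ ($2\le n<\infty$) is the Cuntz algebra, the $C^{*}$-algebra generated by isometries $S_{1},\dots,S_{n}$ satisfying $\sum_{i=1}^{n}S_{i}S_{i}^{*}=1$. The gauge action $\gamma_{z}$ ($z\in\mathbb{T}$) on $\mathcal{O}_{n}$ is the action by automorphisms with $\gamma_{z}(S_{i})=zS_{i}$. $\mathcal{F}_{n}\subset\mathcal{O}_{n}$ is the fixed point algebra of the gauge action; it is isomorphic to the UHF-algebra of type $n^{\infty}$. For $A\subset C$, $A'\cap C=\{x\in C : xa=ax \text{ for all } a\in A\}$. For an inclusion of $C^{*}$-algebras $A\subset C$, the normalizer group is $\mathcal{N}_{C}(A)=\{u\in C : uAu^{*}=A,\ uu^{*}=u^{*}u=1\}$. For a unitary $u$, $\mathrm{Ad}u(x)=uxu^{*}$, and $\mathrm{Ad}u|_{A}$ denotes its restriction to $A$. *)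

(* Defs.v *)
From HB Require Import structures.
From mathcomp Require Import all_boot all_order all_algebra.
From mathcomp Require Import all_classical all_reals all_analysis.
From mathcomp Require Import complex.

Set Implicit Arguments.
Unset Strict Implicit.
Unset Printing Implicit Defensive.

Import Order.TTheory GRing.Theory Num.Theory.
Import numFieldNormedType.Exports.

Local Open Scope classical_set_scope.
Local Open Scope ring_scope.

(* A C*-algebra here is unital and nonzero, as O_n is; C*-subalgebras (below)
   need not contain the unit.  Scalars are R[i], so the norm of an element is a
   nonnegative real viewed in R[i].  The product is introduced on top of
   completeNormedModType, because Hierarchy Builder accepts no structure joining
   the library's normed modules and rings (numDomainType already inherits from
   both); the algType structure is then derived. *)
HB.mixin Record isCStarAlgebra (R : realType) (T : Type)
    of CompleteNormedModule R[i] T := {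
  cstar_mul : T -> T -> T;
  cstar_one : T;
  star : T -> T;
  cstar_mulA : associative cstar_mul;
  cstar_mul1x : left_id cstar_one cstar_mul;
  cstar_mulx1 : right_id cstar_one cstar_mul;
  cstar_mulDl : left_distributive cstar_mul +%R;
  cstar_mulDr : right_distributive cstar_mul +%R;
  cstar_one_neq0 : cstar_one != 0;
  cstar_scaleAl : forall (c : R[i]) (x y : T),
    c *: cstar_mul x y = cstar_mul (c *: x) y;
  cstar_scaleAr : forall (c : R[i]) (x y : T),
    c *: cstar_mul x y = cstar_mul x (c *: y);
  starD : {morph star : x y / x + y};
  starZ : forall (c : R[i]) (x : T), star (c *: x) = (c^*)%C *: star x;
  starM : forall x y : T, star (cstar_mul x y) = cstar_mul (star y) (star x);
  starK : involutive star;
  cstar_normM : forall x y : T, `|cstar_mul x y| <= `|x| * `|y|;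
  cstar_norm : forall x : T, `|cstar_mul (star x) x| = `|x| ^+ 2 }.

#[short(type="cstarAlgType")]
HB.structure Definition CStarAlgebra (R : realType) :=
  {T of isCStarAlgebra R T & CompleteNormedModule R[i] T}.

HB.instance Definition _ (R : realType) (O : cstarAlgType R) :=
  GRing.Zmodule_isNzRing.Build (CStarAlgebra.sort O)
    cstar_mulA cstar_mul1x cstar_mulx1 cstar_mulDl cstar_mulDr cstar_one_neq0.
HB.instance Definition _ (R : realType) (O : cstarAlgType R) :=
  GRing.Lmodule_isLalgebra.Build R[i] (CStarAlgebra.sort O) cstar_scaleAl.
HB.instance Definition _ (R : realType) (O : cstarAlgType R) :=
  GRing.Lalgebra_isAlgebra.Build R[i] (CStarAlgebra.sort O) cstar_scaleAr.

Record cstarSub (R : realType) (O : cstarAlgType R) := CStarSub {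
  csub_set :> set O;
  csub_closed : closed csub_set;
  csub0 : csub_set 0;
  csubD : forall x y, csub_set x -> csub_set y -> csub_set (x + y);
  csubZ : forall (c : R[i]) x, csub_set x -> csub_set (c *: x);
  csubM : forall x y, csub_set x -> csub_set y -> csub_set (x * y);
  csubS : forall x, csub_set x -> csub_set (star x) }.

Section SubalgebraOperations.
Context {R : realType} {O : cstarAlgType R} {A : cstarSub O}.
Implicit Types x y : A.

Definition sub_add x y : A := SigSub (mem_set (csubD (set_valP x) (set_valP y))).
Definition sub_scale (c : R[i]) x : A := SigSub (mem_set (csubZ c (set_valP x))).
Definition sub_mul x y : A := SigSub (mem_set (csubM (set_valP x) (set_valP y))).
Definition sub_star x : A := SigSub (mem_set (csubS (set_valP x))).

End SubalgebraOperations.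

Section AutomorphismGroup.
Context {R : realType} {O : cstarAlgType R}.

Definition is_sub_aut (A : cstarSub O) (f : A -> A) : Prop :=
  [/\ bijective f,
      {morph f : x y / sub_add x y},
      forall c, {morph f : x / sub_scale c x},
      {morph f : x y / sub_mul x y} &
      {morph f : x / sub_star x}].

Record Aut (A : cstarSub O) :=
  MkAut { aut_fun :> A -> A; _ : `[< is_sub_aut aut_fun >] }.

HB.instance Definition _ (A : cstarSub O) := [isSub for @aut_fun A].
HB.instance Definition _ (A : cstarSub O) := [Choice of Aut A by <:].

Section Group.
Variable A : cstarSub O.
Implicit Types f g h : Aut A.

Lemma autP f : is_sub_aut f.
Proof. by apply/asboolP; case: f. Qed.

Lemma aut_ext f g : (forall a, f a = g a) -> f = g.
Proof. by move=> fg; apply: val_inj; apply: funext. Qed.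

Lemma is_sub_aut_id : is_sub_aut (@id A).
Proof. by split=> //; exists id. Qed.

Lemma is_sub_aut_comp f g : is_sub_aut (f \o g : A -> A).
Proof.
have [bf fD fZ fM fS] := autP f; have [bg gD gZ gM gS] := autP g.
split; first exact: bij_comp.
- by move=> x y /=; rewrite gD fD.
- by move=> c x /=; rewrite gZ fZ.
- by move=> x y /=; rewrite gM fM.
- by move=> x /=; rewrite gS fS.
Qed.

Lemma aut_inv_subproof f :
  exists h : Aut A, (forall x, h (f x) = x) /\ (forall x, f (h x) = x).
Proof.
have [[k fk kf] fD fZ fM fS] := autP f.
have kP : is_sub_aut k.
  split; first by exists f.
  - by move=> x y; apply: (can_inj fk); rewrite fD !kf.
  - by move=> c x; apply: (can_inj fk); rewrite fZ !kf.
  - by move=> x y; apply: (can_inj fk); rewrite fM !kf.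
  - by move=> x; apply: (can_inj fk); rewrite fS !kf.
by exists (MkAut (asboolT kP)).
Qed.

Definition aut_one : Aut A := MkAut (asboolT is_sub_aut_id).
Definition aut_mul f g : Aut A := MkAut (asboolT (is_sub_aut_comp f g)).
Definition aut_inv f : Aut A := sval (cid (aut_inv_subproof f)).

Lemma aut_mulA : associative aut_mul.
Proof. by move=> f g h; apply: aut_ext. Qed.
Lemma aut_mul1f : left_id aut_one aut_mul.
Proof. by move=> f; apply: aut_ext. Qed.
Lemma aut_mulf1 : right_id aut_one aut_mul.
Proof. by move=> f; apply: aut_ext. Qed.
Lemma aut_mulVf : left_inverse aut_one aut_inv aut_mul.
Proof.
move=> f; apply: aut_ext => x /=; rewrite /aut_inv.
by case: cid => h [] /=.
Qed.
Lemma aut_mulfV : right_inverse aut_one aut_inv aut_mul.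
Proof.
move=> f; apply: aut_ext => x /=; rewrite /aut_inv.
by case: cid => h [] /=.
Qed.

End Group.

HB.instance Definition _ (A : cstarSub O) := isGroup.Build (Aut A)
  (@aut_mulA A) (@aut_mul1f A) (@aut_mulf1 A) (@aut_mulVf A) (@aut_mulfV A).

End AutomorphismGroup.

Section Cuntz.
Context {R : realType} {O : cstarAlgType R}.

Definition relative_commutant (C A : set O) : set O :=
  [set x | C x /\ forall a, A a -> x * a = a * x].

(* V is meant to be a linear subspace, hence the absence of a span. *)
Definition finite_dimensional (V : set O) : Prop :=
  exists (m : nat) (e : 'I_m -> O), (forall k, V (e k)) /\
    forall x, V x -> exists c : 'I_m -> R[i], x = \sum_(k < m) c k *: e k.

Definition normalizer (C A : set O) : set O :=
  [set u | [/\ C u, [set u * a * star u | a in A] = A,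
               u * star u = 1 & star u * u = 1]].

Definition Ad_restrictions (C : set O) (A : cstarSub O) : set (Aut A) :=
  [set f | exists2 u, normalizer C A u &
                      forall a : A, \val (f a) = u * \val a * star u].

(* By Cuntz's theorem any two C*-algebras generated by such isometries are
   isomorphic via S_i |-> S'_i (n >= 2), so this characterizes O_n. *)
Definition is_cuntz_algebra (n : nat) (S : 'I_n -> O) : Prop :=
  [/\ forall i, star (S i) * S i = 1,
      \sum_(i < n) S i * star (S i) = 1 &
      forall B : cstarSub O, (forall i, csub_set B (S i)) -> B = setT :> set O].

Definition is_star_automorphism (f : O -> O) : Prop :=
  [/\ bijective f, linear f, {morph f : x y / x * y} &
      {morph f : x / star x}].

(* Only the values at z with |z| = 1 are relevant. *)
Definition is_gauge_action (n : nat) (S : 'I_n -> O) (gam : R[i] -> O -> O) :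
    Prop :=
  [/\ forall z, `|z| = 1 -> is_star_automorphism (gam z),
      gam 1 =1 id,
      forall z w, `|z| = 1 -> `|w| = 1 -> gam (z * w) =1 gam z \o gam w &
      forall z i, `|z| = 1 -> gam z (S i) = z *: S i].

Definition gauge_fixed (gam : R[i] -> O -> O) : set O :=
  [set x | forall z, `|z| = 1 -> gam z x = x].

End Cuntz.
Arguments Ad_restrictions {R O} C A _.

Definition is_subgroup (T : groupType) (G : set T) : Prop :=
  [/\ G 1%g, forall g h, G g -> G h -> G (g * h)%g & forall g, G g -> G g^-1%g].

Definition left_cosets (T : groupType) (H G : set T) : set (set T) :=
  [set [set (g * h)%g | h in H] | g in G].

(* Main.v *)
(* If U normalizes A then its Fourier coefficients U_k for the gauge action
   satisfy U_k a = Ad U(a) U_k on A, so U_k^* U_k and U_k U_k^* lie in the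
   finite-dimensional algebra B = A' /\ F_n, and U_k U_l^* lies in the degree k - l
   part of A' /\ O_n.  The trace of F_n scales by n^-k between x^* x and x x^* for x
   of degree k; as it is faithful on B, this forces U_k = 0 for |k| > K with K
   independent of U, and a count of orthonormal vectors shows that each graded
   part of A' /\ O_n is finite-dimensional.  Hence the arrays (U_k U_l^* ) form a
   totally bounded set.  If the arrays of U and W are close, then, because
   sum_k U_k^* U_k = 1, the element x = sum_k W_k^* U_k of F_n is almost unitary; it
   intertwines a |-> a and Ad (W^* U), so its unitary part lies in N_{F_n}(A) and
   Ad U, Ad W lie in the same left coset of H.

   Averages over roots of unity replace the integrals over the circle, and the
   trace is obtained as the limit of x |-> n^-N sum_{|m| = N} S_m^* x S_m. *)
Require Import Defs.
From mathcomp Require Import all_boot all_order all_algebra.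
From mathcomp Require Import all_classical all_reals all_analysis.
From mathcomp Require Import complex.
From mathcomp Require Import ring lra zify.

Set Implicit Arguments.
Unset Strict Implicit.
Unset Printing Implicit Defensive.

Import Order.TTheory GRing.Theory Num.Theory.
Import numFieldNormedType.Exports.

Local Open Scope classical_set_scope.
Local Open Scope ring_scope.

(** * Real-valued norms and convergence *)

(** No functional calculus, spectrum or order on the algebra is used. Three devices take their
    place. A contraction solves [(1 + y)^2 (1 - d) = 1] for [|d| <= 1/8]; it bounds the gauge
    automorphisms, gives an order estimate for the trace, and yields the final unitary part. Powers
    of self-adjoint elements give the faithfulness of the trace. An averaging argument over signs
    shows that 1 is an extreme point of the unit ball, whence the ranges of the [S i] are
    orthogonal. The arrays are needed because [U_k] itself intertwines A with its twist by Ad U,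
    hence lies in a space that varies with U; in the products of a coefficient with the adjoint of
    another the twist cancels, and a single finite-dimensional space serves all U. The degree bound
    must be uniform in U for a quantitative reason: the precision demanded of the arrays is of order
    [(2 K + 1)^-2], and it has to be fixed before the unitaries are sorted into finitely many
    labels. *)

Definition nrm (R : realType) (V : normedZmodType R[i]) (x : V) : R :=
  complex.Re `|x|.

(* Convergence is stated with real-valued bounds so that the order reasoning
   takes place in R rather than in the partially ordered R[i]. *)
Definition tends (R : realType) (V : normedZmodType R[i]) (u : nat -> V)
    (l : V) : Prop :=
  forall e : R, 0 < e -> exists M, forall m, (M <= m)%N -> nrm (u m - l) <= e.

Section Norm.
Context {R : realType} {V : normedZmodType R[i]}.
Implicit Types x y : V.

Lemma nrmE x : `|x| = (nrm x)%:C%C.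
Proof. by rewrite /nrm RRe_real ?normr_real. Qed.

Lemma nrm_ge0 x : 0 <= nrm x.
Proof. by rewrite -lecR rmorph0 -nrmE normr_ge0. Qed.

Lemma nrm0 : nrm (0 : V) = 0.
Proof. by rewrite /nrm normr0. Qed.

Lemma nrm_eq0 x : nrm x = 0 -> x = 0.
Proof. by move=> x0; apply/normr0_eq0; rewrite nrmE x0. Qed.

Lemma nrm_gt0 x : x != 0 -> 0 < nrm x.
Proof.
move=> x0; rewrite lt_def nrm_ge0 andbT.
by apply: contraNneq x0 => /nrm_eq0 ->.
Qed.

Lemma nrmN x : nrm (- x) = nrm x.
Proof. by rewrite /nrm normrN. Qed.

Lemma nrmBC x y : nrm (x - y) = nrm (y - x).
Proof. by rewrite -nrmN opprB. Qed.

Lemma ler_nrmD x y : nrm (x + y) <= nrm x + nrm y.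
Proof. by rewrite -lecR rmorphD /= -!nrmE ler_normD. Qed.

Lemma ler_nrmB x y : nrm (x - y) <= nrm x + nrm y.
Proof. by rewrite -(nrmN y) ler_nrmD. Qed.

Lemma ler_nrm_dist x y z : nrm (x - z) <= nrm (x - y) + nrm (y - z).
Proof.
have -> : x - z = (x - y) + (y - z) by rewrite addrA subrK.
exact: ler_nrmD.
Qed.

Lemma ler_nrm_sum (I : Type) (r : seq I) (P : pred I) (F : I -> V) :
  nrm (\sum_(i <- r | P i) F i) <= \sum_(i <- r | P i) nrm (F i).
Proof.
elim/big_ind2: _ => [|x a y b xa yb|//]; first by rewrite nrm0.
by apply: le_trans (ler_nrmD _ _) _; apply: lerD.
Qed.

Lemma nrm_small x : (forall e : R, 0 < e -> nrm x <= e) -> x = 0.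
Proof.
move=> H; apply: nrm_eq0; apply/eqP; rewrite eq_le nrm_ge0 andbT.
by apply/ler_addgt0Pr => e e0; rewrite add0r H.
Qed.

Lemma tends_unique (u : nat -> V) l l' : tends u l -> tends u l' -> l = l'.
Proof.
move=> ul ul'; apply/eqP; rewrite -subr_eq0; apply/eqP/nrm_small => e e0.
have e2 : 0 < e / 2 by rewrite divr_gt0.
have [M /(_ (maxn M _) (leq_maxl _ _)) HM] := ul _ e2.
have [M' HM'] := ul' _ e2.
have := HM' _ (leq_maxr M M'); have := HM M'; rewrite nrmBC => a b.
by rewrite (splitr e); apply: le_trans (ler_nrm_dist _ _ _) (lerD a b).
Qed.

Lemma tends_ev (u : nat -> V) l M :
  (forall m, (M <= m)%N -> u m = l) -> tends u l.
Proof.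
by move=> H e /ltW e0; exists M => m /H ->; rewrite subrr nrm0.
Qed.

Lemma tends_ext (u v : nat -> V) l :
  (forall m, u m = v m) -> tends u l -> tends v l.
Proof. by move=> /funext ->. Qed.

Lemma tends_nrm (u : nat -> V) l (c : R) :
  tends u l -> (forall m, nrm (u m) <= c) -> nrm l <= c.
Proof.
move=> ul uc; apply/ler_addgt0Pr => e e0; have [M /(_ _ (leqnn M)) HM] := ul _ e0.
rewrite -(subrKC (u M) l); apply: le_trans (ler_nrmD _ _) _.
by rewrite lerD // nrmBC.
Qed.

Lemma tendsD (u v : nat -> V) l k :
  tends u l -> tends v k -> tends (fun m => u m + v m) (l + k).
Proof.
move=> ul vk e e0; have e2 : 0 < e / 2 by rewrite divr_gt0.
have [M HM] := ul _ e2; have [P HP] := vk _ e2.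
exists (maxn M P) => m; rewrite geq_max => /andP[/HM a /HP b].
rewrite (splitr e) opprD addrACA; apply: le_trans (ler_nrmD _ _) _.
exact: lerD.
Qed.

Lemma tends_shift (u : nat -> V) l : tends u l -> tends (fun m => u m.+1) l.
Proof.
by move=> ul e /ul[M HM]; exists M => m Mm; apply: HM; rewrite ltnW.
Qed.

(** Sequential closedness in the sense of [tends]: the limits taken below are all limits of
    sequences, namely iterations, averages over roots of unity and approximations. *)
Definition tclosed (Z : set V) : Prop :=
  forall u l, (forall m, Z (u m)) -> tends u l -> Z l.

Lemma tclosed_dense (Z : set V) x : tclosed Z ->
  (forall e : R, 0 < e -> exists2 y, Z y & nrm (x - y) <= e) -> Z x.
Proof.
move=> Zc H.
have e0 m : 0 < (m.+1%:R^-1 : R) by rewrite invr_gt0 ltr0n.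
pose u m := sval (cid2 (H _ (e0 m))).
have uP m : Z (u m) /\ nrm (x - u m) <= m.+1%:R^-1.
  by rewrite /u; case: cid2 => y /=.
apply: (Zc u) => [m|e ep]; first by case: (uP m).
exists (Num.truncn e^-1) => m Mm; rewrite nrmBC; case: (uP m) => _ /le_trans; apply.
rewrite invf_ple ?posrE ?ltr0n //; apply: ltW.
apply: lt_le_trans (_ : (Num.truncn e^-1).+1%:R <= _).
  by rewrite truncnS_gt.
by rewrite ler_nat.
Qed.

End Norm.

Lemma ler_nrm_bound (R : realType) (V W : normedZmodType R[i]) (f : V -> W)
    (C : R) (u : nat -> V) l :
  0 <= C -> (forall x y, nrm (f x - f y) <= C * nrm (x - y)) ->
  tends u l -> tends (f \o u) (f l).
Proof.
move=> C0 fC ul e e0; have C1 : 0 < C + 1 by rewrite ltr_pwDr.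
have [M HM] := ul _ (divr_gt0 e0 C1).
exists M => m /HM a /=; apply: le_trans (fC _ _) _.
rewrite ler_pdivlMr // in a; apply: le_trans a.
by rewrite mulrC ler_wpM2l ?nrm_ge0 // lerDl.
Qed.

Section Scalars.
Context {R : realType}.
Implicit Types c d : R[i].

Lemma nrmcE c : (nrm c)^+2 = complex.Re c ^+ 2 + complex.Im c ^+ 2.
Proof. by rewrite /nrm normc_def /= sqr_sqrtr // addr_ge0 ?sqr_ge0. Qed.

Lemma nrmcM c d : nrm (c * d) = nrm c * nrm d.
Proof. by apply: (@complexI R); rewrite rmorphM /= -!nrmE normrM. Qed.

Lemma nrmcJ c : nrm (c^*)%C = nrm c.
Proof. by rewrite /nrm normcJ. Qed.

Lemma conjcM c d : ((c * d)^*)%C = (c^*)%C * (d^*)%C.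
Proof. exact: rmorphM. Qed.

Lemma nrm_real (a : R) : nrm (a%:C%C : R[i]) = `|a|.
Proof. by rewrite /nrm normc_def /= expr0n addr0 sqrtr_sqr. Qed.

Lemma nrm_nat k : nrm (k%:R : R[i]) = k%:R.
Proof. by rewrite /nrm normr_nat -(rmorph_nat (real_complex R)). Qed.

Lemma nrmcV c : nrm (c^-1) = (nrm c)^-1.
Proof. by apply: (@complexI R); rewrite fmorphV /= -!nrmE normfV. Qed.

Lemma mulcJ c : c * (c^*)%C = ((nrm c)^+2)%:C%C.
Proof. by rewrite -sqr_normc rmorphXn /= -nrmE. Qed.

Lemma ler_Re_nrm c : `|complex.Re c| <= nrm c.
Proof.
rewrite -(@ler_pXn2r _ 2) ?nnegrE ?nrm_ge0 // nrmcE real_normK ?num_real //.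
by rewrite lerDl sqr_ge0.
Qed.

Lemma ler_Im_nrm c : `|complex.Im c| <= nrm c.
Proof.
rewrite -(@ler_pXn2r _ 2) ?nnegrE ?nrm_ge0 // nrmcE real_normK ?num_real //.
by rewrite lerDr sqr_ge0.
Qed.

Lemma ler_nrm_ReIm c : nrm c <= `|complex.Re c| + `|complex.Im c|.
Proof.
rewrite -(@ler_pXn2r _ 2) ?nnegrE ?addr_ge0 ?nrm_ge0 // nrmcE.
rewrite -(real_normK (num_real (complex.Re c))).
rewrite -(real_normK (num_real (complex.Im c))).
have := normr_ge0 (complex.Re c); have := normr_ge0 (complex.Im c).
by move: `|_| `|_| => a b a0 b0; nra.
Qed.

Lemma nrm_eq1 c : `|c| = 1 -> nrm c = 1.
Proof. by rewrite nrmE => /(congr1 (@complex.Re R)). Qed.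

Lemma conjc_nrm1 c : nrm c = 1 -> (c^*)%C = c^-1.
Proof.
move=> c1; have c0 : c != 0.
  by apply: contra_eq_neq c1 => ->; rewrite nrm0 eq_sym oner_neq0.
by apply: (mulfI c0); rewrite mulcJ c1 expr1n mulfV.
Qed.

Lemma nrm_cauchy_cvg (u : nat -> R[i]) :
  (forall e : R, 0 < e -> exists M, forall m p, (M <= m)%N -> (M <= p)%N ->
     nrm (u m - u p) <= e) -> exists l, tends u l.
Proof.
have realC (v : nat -> R) : (forall e : R, 0 < e -> exists M, forall m p,
    (M <= m)%N -> (M <= p)%N -> `|v m - v p| <= e) ->
    exists l, forall e, 0 < e -> exists M, forall m, (M <= m)%N -> `|v m - l| <= e.
  move=> H; have /cvg_ex[l /= vl] : cvgn v.
    apply/cauchy_cvgP/cauchy_exP => _/posnumP[e].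
    have [M HM] := H (e%:num / 2) ltac:(by []).
    exists (v M); exists M => // m /= Mm; apply: le_lt_trans (HM _ _ (leqnn M) Mm) _.
    by rewrite ltr_pdivrMr // ltr_pMr // ltr1n.
  exists l => e e0.
  move/cvgrPdist_le : vl => /(_ _ e0)[M _ HM]; exists M => m Mm.
  by rewrite distrC; exact: HM.
move=> H.
have [e e0|a Ha] := realC (fun m => complex.Re (u m)).
  have [M HM] := H _ e0; exists M => m p Mm Mp.
  by rewrite -raddfB; apply: le_trans (ler_Re_nrm _) (HM _ _ _ _).
have [e e0|b Hb] := realC (fun m => complex.Im (u m)).
  have [M HM] := H _ e0; exists M => m p Mm Mp.
  by rewrite -raddfB; apply: le_trans (ler_Im_nrm _) (HM _ _ _ _).
exists (a +i* b)%C => e e0; have e2 : 0 < e / 2 by rewrite divr_gt0.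
have [M HM] := Ha _ e2; have [P HP] := Hb _ e2.
exists (maxn M P) => m; rewrite geq_max => /andP[/HM c /HP d].
rewrite (splitr e); apply: le_trans (ler_nrm_ReIm _) _.
by case: (u m) c d => x y /= c d; exact: lerD.
Qed.

End Scalars.

Section CStar.
Context {R : realType} {O : cstarAlgType R}.
Implicit Types (x y z d h : O) (c : R[i]).

Lemma nrmZ c x : nrm (c *: x) = nrm c * nrm x.
Proof. by apply: (@complexI R); rewrite rmorphM /= -!nrmE normrZ. Qed.

Lemma mulrn_scale x k : x *+ k = k%:R *: x.
Proof. by rewrite scaler_nat. Qed.

Lemma nrmM x y : nrm (x * y) <= nrm x * nrm y.
Proof. by rewrite -lecR rmorphM /= -!nrmE; exact: cstar_normM. Qed.

Lemma nrm_starM x : nrm (star x * x) = nrm x ^+ 2.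
Proof.
by apply: (@complexI R); rewrite rmorphXn /= -!nrmE; exact: cstar_norm.
Qed.

Lemma nrm_star x : nrm (star x) = nrm x.
Proof.
suff H y : nrm y <= nrm (star y).
  by apply/eqP; rewrite eq_le H andbT -{2}(starK x) H.
have [->|y0] := eqVneq y 0; first by rewrite nrm0 nrm_ge0.
have := nrmM (star y) y; rewrite nrm_starM expr2 ler_pM2r //.
exact: nrm_gt0.
Qed.

Lemma nrmM_star x : nrm (x * star x) = nrm x ^+ 2.
Proof. by rewrite -{1}(starK x) nrm_starM nrm_star. Qed.

Lemma star_mul x y : star (x * y) = star y * star x.
Proof. exact: starM. Qed.

Lemma star1 : star (1 : O) = 1.
Proof. by rewrite -[LHS]mulr1 -{2}(starK 1) -star_mul mulr1 starK. Qed.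

Lemma star0 : star (0 : O) = 0.
Proof. by apply: (addIr (star 0)); rewrite -starD add0r add0r. Qed.

Lemma starN x : star (- x) = - star x.
Proof. by apply: (addIr (star x)); rewrite -starD !addNr star0. Qed.

Lemma starB x y : star (x - y) = star x - star y.
Proof. by rewrite starD starN. Qed.

Lemma star_sum (I : Type) (r : seq I) (P : pred I) (F : I -> O) :
  star (\sum_(i <- r | P i) F i) = \sum_(i <- r | P i) star (F i).
Proof. exact: (big_morph _ (@starD _ _) star0). Qed.

Lemma nrm1 : nrm (1 : O) = 1.
Proof.
have /eqP := nrm_starM 1; rewrite star1 mulr1 eq_sym expr2 -subr_eq0.
rewrite -{3}(mulr1 (nrm (1 : O))) -mulrBr mulf_eq0 subr_eq0 => /orP[/eqP/nrm_eq0/eqP|/eqP//].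
by rewrite oner_eq0.
Qed.

Lemma nrmA c : nrm (c%:A : O) = nrm c.
Proof. by rewrite nrmZ nrm1 mulr1. Qed.

Lemma nrmX x k : nrm (x ^+ k) <= nrm x ^+ k.
Proof.
elim: k => [|k IH]; first by rewrite !expr0 nrm1.
by rewrite !exprS; apply: le_trans (nrmM _ _) _; rewrite ler_wpM2l ?nrm_ge0.
Qed.

Lemma starX x k : star (x ^+ k) = star x ^+ k.
Proof. by elim: k => [|k IH]; rewrite ?expr0 ?star1 // exprS exprSr star_mul IH. Qed.

(** Repeated squaring by the C*-identity; the exact norm of these powers does the work of the
    spectral radius formula. *)
Lemma nrmX2k x k : star x = x -> nrm (x ^+ (2 ^ k)) = nrm x ^+ (2 ^ k).
Proof.
move=> xs; elim: k => [|k IH]; first by rewrite expn0 !expr1.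
by rewrite expnS mulnC !exprM -IH -nrm_starM starX xs expr2.
Qed.

Lemma nrm_cauchy_tends (u : nat -> O) :
  (forall e : R, 0 < e -> exists M, forall m p, (M <= m)%N -> (M <= p)%N ->
     nrm (u m - u p) <= e) -> exists l, tends u l.
Proof.
move=> H; have /cvg_ex[l /= ul] : cvgn u.
  apply/cauchy_cvgP/cauchy_exP => e e0.
  have eE : e = (complex.Re e)%:C%C by rewrite RRe_real // gtr0_real.
  have re0 : 0 < complex.Re e by rewrite -ltcR -eE.
  have [M HM] := H (complex.Re e / 2) ltac:(by rewrite divr_gt0).
  exists (u M); exists M => // m /= Mm; rewrite -ball_normE /= nrmE eE ltcR.
  apply: le_lt_trans (HM _ _ (leqnn M) Mm) _.
  by rewrite ltr_pdivrMr // ltr_pMr // ltr1n.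
exists l => e e0.
have eC : 0 < e%:C%C :> R[i] by rewrite ltcR.
move/cvgrPdist_le : ul => /(_ _ eC)[M _ HM]; exists M => m Mm.
by rewrite nrmBC -lecR -nrmE; exact: HM.
Qed.

Lemma tendsMl y (u : nat -> O) l : tends u l -> tends (fun m => y * u m) (y * l).
Proof.
apply: (@ler_nrm_bound _ _ _ (fun x => y * x) (nrm y) u); rewrite ?nrm_ge0 // => a b.
by rewrite -mulrBr nrmM.
Qed.

Lemma tendsMr y (u : nat -> O) l : tends u l -> tends (fun m => u m * y) (l * y).
Proof.
apply: (@ler_nrm_bound _ _ _ (fun x => x * y) (nrm y) u); rewrite ?nrm_ge0 // => a b.
by rewrite -mulrBl (mulrC (nrm y)) nrmM.
Qed.

Lemma tendsZ c (u : nat -> O) l : tends u l -> tends (fun m => c *: u m) (c *: l).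
Proof.
apply: (@ler_nrm_bound _ _ _ ( *:%R c) (nrm c)); rewrite ?nrm_ge0 // => a b.
by rewrite -scalerBr nrmZ.
Qed.

Lemma tends_star (u : nat -> O) l : tends u l -> tends (fun m => star (u m)) (star l).
Proof.
apply: (@ler_nrm_bound _ _ _ star 1); rewrite ?ler01 // => a b.
by rewrite -starB nrm_star mul1r.
Qed.

Lemma tclosed_commutant (P : set O) : tclosed [set x | forall a, P a -> x * a = a * x].
Proof.
move=> u l uZ ul a Pa; apply: (tends_unique (tendsMr a ul)).
by under [X in tends X]eq_fun do rewrite (uZ _ _ Pa); exact: tendsMl.
Qed.

Lemma tclosed_self : tclosed [set x : O | star x = x].
Proof.
move=> u l uZ ul; apply: (tends_unique (tends_star ul)).
by under [X in tends X]eq_fun do rewrite uZ.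
Qed.

End CStar.

Lemma half_pow_small (R : realType) (e : R) : 0 < e -> exists M, 2^-1 ^+ M <= e.
Proof.
move=> e0; exists (Num.truncn e^-1).+1; rewrite exprVn invf_ple ?posrE ?exprn_gt0 //.
apply: ltW; apply: lt_le_trans (truncnS_gt _) _.
by rewrite -natrX ler_nat ltnW // ltn_expl.
Qed.

(** * Inverse square roots and boundedness of *-homomorphisms *)

Section AdditiveIdentities.
Variable V : zmodType.

(** Syntax for the reflexive tactic [abel] below, which proves abelian group identities while
    treating noncommutative products and scalings as atoms. *)
Inductive zexpr := ZVar of nat | ZZero | ZAdd of zexpr & zexpr | ZOpp of zexpr.

Fixpoint zeval (s : seq V) e : V :=
  match e with
  | ZVar i => nth 0 s i | ZZero => 0
  | ZAdd a b => zeval s a + zeval s b | ZOpp a => - zeval s a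
  end.

Fixpoint zcoef e i : int :=
  match e with
  | ZVar j => (i == j)%:Z | ZZero => 0
  | ZAdd a b => zcoef a i + zcoef b i | ZOpp a => - zcoef a i
  end.

Lemma zevalE s e : zeval s e = \sum_(i < size s) s`_i *~ zcoef e i.
Proof.
elim: e => [j||a IHa b IHb|a IH] /=.
- have [js|sj] := ltnP j (size s).
    rewrite (bigD1 (Ordinal js)) //= eqxx big1 ?addr0 // => i.
    by rewrite -val_eqE /= => /negPf ->; rewrite mulr0z.
  rewrite nth_default // big1 // => i _.
  by rewrite ltn_eqF ?mulr0z // (leq_trans (ltn_ord i)).
- by rewrite big1 // => i _; rewrite mulr0z.
- by rewrite IHa IHb -big_split; apply: eq_bigr => i _; rewrite mulrzDr.
- by rewrite IH -sumrN; apply: eq_bigr => i _; rewrite mulrNz.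
Qed.

Lemma zeval_eq s e f :
  all (fun i => zcoef e i == zcoef f i) (iota 0 (size s)) -> zeval s e = zeval s f.
Proof.
move=> /allP H; rewrite !zevalE; apply: eq_bigr => i _; congr (_ *~ _).
by apply/eqP/H; rewrite mem_iota ltn_ord.
Qed.

End AdditiveIdentities.

(* Equality of atoms up to the structure instances hidden in the operations. *)
Ltac zsame x y :=
  first
    [ constr_eq x y
    | lazymatch x with
      | ?a * ?b => lazymatch y with ?c * ?d => zsame a c; zsame b d end
      | ?a *: ?b => lazymatch y with ?c *: ?d => zsame a c; zsame b d end
      | ?a + ?b => lazymatch y with ?c + ?d => zsame a c; zsame b d end
      | - ?a => lazymatch y with - ?c => zsame a c end
      | 1 => lazymatch y with 1 => idtac end
      end ].
Ltac zmem x s :=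
  match s with
  | nil => constr:(false)
  | ?y :: _ => let _ := match goal with _ => zsame x y end in constr:(true)
  | _ :: ?t => zmem x t
  end.
Ltac zidx x s :=
  match s with
  | ?y :: _ => let _ := match goal with _ => zsame x y end in constr:(0%N)
  | _ :: ?t => let i := zidx x t in constr:(S i)
  end.
Ltac zatoms e s :=
  match e with
  | 0 => s
  | ?a + ?b => let t := zatoms a s in zatoms b t
  | - ?a => zatoms a s
  | _ => match zmem e s with true => s | false => constr:(e :: s) end
  end.
Ltac zreify e s :=
  match e with
  | 0 => constr:(ZZero)
  | ?a + ?b => let p := zreify a s in let q := zreify b s in constr:(ZAdd p q)
  | - ?a => let p := zreify a s in constr:(ZOpp p)
  | _ => let i := zidx e s in constr:(ZVar i)
  end.
Ltac abel :=
  match goal with |- @eq ?T ?a ?b =>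
    let s0 := zatoms a (@nil T) in
    let s := zatoms b s0 in
    let p := zreify a s in let q := zreify b s in
    exact: (@zeval_eq _ s p q isT)
  end.

Lemma comm_1D (T : pzRingType) (a b : T) : a * b = b * a -> (1 + a) * b = b * (1 + a).
Proof. by move=> ab; rewrite mulrDl mulrDr mul1r mulr1 ab. Qed.

Lemma comm_1B (T : pzRingType) (a b : T) : a * b = b * a -> a * (1 - b) = (1 - b) * a.
Proof. by move=> ab; rewrite mulrBl mulrBr mul1r mulr1 ab. Qed.

Section InverseSquareRoot.
Context {R : realType} {O : cstarAlgType R}.
Implicit Types (x y z d h : O) (c : R[i]).

Lemma scaler_half x : 2^-1 *: (x + x) = x.
Proof. by rewrite scalerDr -scalerDl -[2^-1]div1r -splitr scale1r. Qed.

Definition isqrt_step d y : O := 2^-1 *: (d + (y + y) * d + y * y * d - y * y).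

(* The fixed points y of isqrt_step d are the solutions of
   (1 + y)^2 (1 - d) = 1. *)
Lemma isqrt_exists d (Z : set O) : nrm d <= 8^-1 -> tclosed Z -> Z 0 ->
  (forall y, Z y -> Z (isqrt_step d y)) ->
  exists2 y, Z y & (1 + y) * (1 + y) * (1 - d) = 1.
Proof.
move=> d8 Zc Z0 Zs.
have nrm2V : nrm (2^-1 : R[i]) = 2^-1 by rewrite nrmcV nrm_nat.
(* The radii 1/4 for [y] and 1/8 for [d] make the step map the ball into itself and contract
   distances there by 1/2. *)
have ball y : nrm y <= 4^-1 -> nrm (isqrt_step d y) <= 4^-1.
  move=> y4; rewrite nrmZ nrm2V; have := nrm_ge0 y; have := nrm_ge0 d.
  have := ler_nrmD (d + (y + y) * d + y * y * d) (- (y * y)); rewrite nrmN.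
  have := ler_nrmD (d + (y + y) * d) (y * y * d); have := ler_nrmD d ((y + y) * d).
  have := nrmM (y + y) d; have := nrmM (y * y) d; have := nrmM y y.
  have := ler_nrmD y y; have := nrm_ge0 (y + y); have := nrm_ge0 (y * y).
  move=> h1 h2 h3 h4 h5 h6 h7 h8 h9 h10 h11.
  have k1 : nrm y * nrm y <= 16^-1 by nra.
  have k2 : nrm (y * y) * nrm d <= 16^-1 by nra.
  have k3 : nrm (y + y) * nrm d <= 16^-1 by nra.
  lra.
have contr y z : nrm y <= 4^-1 -> nrm z <= 4^-1 ->
    nrm (isqrt_step d y - isqrt_step d z) <= 2^-1 * nrm (y - z).
  move=> y4 z4; rewrite -scalerBr nrmZ nrm2V ler_wpM2l ?invr_ge0 //.
  pose w := y - z; pose s := y * w + w * z.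
  have sE : y * y - z * z = s by rewrite /s /w mulrBr mulrBl addrA subrK.
  have -> : d + (y + y) * d + y * y * d - y * y - (d + (z + z) * d + z * z * d - z * z) =
      (w + w) * d + s * d - s.
    by rewrite -sE /w !(mulrDl, mulNr); abel.
  have := ler_nrmB ((w + w) * d + s * d) s; have := ler_nrmD ((w + w) * d) (s * d).
  have := ler_nrmD w w; have := nrmM (w + w) d; have := nrmM s d.
  have := ler_nrmD (y * w) (w * z); have := nrmM y w; have := nrmM w z.
  have := nrm_ge0 w; have := nrm_ge0 d; have := nrm_ge0 s.
  have := nrm_ge0 (w + w); have := nrm_ge0 y; have := nrm_ge0 z.
  rewrite -/s -/w; clear sE; clearbody s w => h1 h2 h3 h4 h5 h6 h7 h8 h9 h10 h11 h12 h13 h14.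
  have k1 : nrm y * nrm w <= 4^-1 * nrm w by nra.
  have k2 : nrm w * nrm z <= 4^-1 * nrm w by nra.
  have k3 : nrm s <= 2^-1 * nrm w by lra.
  have k4 : nrm s * nrm d <= 8^-1 * nrm s by nra.
  have k5 : nrm (w + w) * nrm d <= 8^-1 * nrm (w + w) by nra.
  lra.
(* The iteration starts at 0, which is in [Z], so the limit inherits every closed condition that the
   step preserves: self-adjointness, commutation relations, degree 0. *)
pose u m := iter m (isqrt_step d) 0.
have u4 m : nrm (u m) <= 4^-1.
  by elim: m => [|m IH]; [rewrite nrm0 invr_ge0|exact: ball].
have uZ m : Z (u m) by elim: m => [|m IH] //=; exact: Zs.
have uu m p : nrm (u m - u (m + p)%N) <= 2^-1 ^+ m.
  elim: m => [|m IH].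
    rewrite add0n expr0; have := ler_nrmB (u 0%N) (u p).
    by have := u4 0%N; have := u4 p; lra.
  rewrite addSn exprS; apply: le_trans (contr _ _ (u4 _) (u4 _)) _.
  by rewrite ler_wpM2l ?invr_ge0.
have [|y uy] := @nrm_cauchy_tends _ _ u.
  move=> e e0; have [M HM] := half_pow_small (divr_gt0 e0 (ltr0n _ 2)).
  exists M => m p /subnKC <- /subnKC <-.
  have := ler_nrm_dist (u (M + (m - M))%N) (u M) (u (M + (p - M))%N).
  have := uu M (m - M)%N; have := uu M (p - M)%N; rewrite nrmBC => a b.
  by rewrite nrmBC in b; lra.
have y4 : nrm y <= 4^-1 by exact: tends_nrm uy u4.
have yE : y = isqrt_step d y.
  apply: (tends_unique (tends_shift uy)) => e e0.
  have [M HM] := uy _ e0; exists M => m /HM a.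
  apply: le_trans (contr _ _ (u4 m) y4) _.
  by have := nrm_ge0 (u m - y); lra.
exists y; first exact: Zc uy.
have yyE : y + y = d + (y + y) * d + y * y * d - y * y.
  by rewrite -[RHS]scaler_half scalerDr -/(isqrt_step d y) -yE.
rewrite mulrBr mulr1.
have -> : (1 + y) * (1 + y) = 1 + ((y + y) + y * y).
  by rewrite mulrDl mul1r mulrDr mulr1 !addrA.
by rewrite {1}yyE !(mulrDl, mul1r); abel.
Qed.

Lemma star_isqrt_step d y : star d = d -> star y = y -> y * d = d * y ->
  star (isqrt_step d y) = isqrt_step d y.
Proof.
move=> ds ys yd; rewrite /isqrt_step starZ starB !starD !star_mul !starD ds ys.
have -> : ((2^-1 : R[i])^*)%C = 2^-1 by rewrite conjc_inv conjc_nat.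
congr (_ *: (_ + _ + _ - _)); first by rewrite mulrDl mulrDr yd.
by rewrite mulrA -yd -mulrA -yd mulrA.
Qed.

Lemma comm_isqrt_step d y a : y * a = a * y -> d * a = a * d ->
  isqrt_step d y * a = a * isqrt_step d y.
Proof.
move=> ya da; rewrite /isqrt_step -scalerAl -scalerAr; congr (_ *: _).
have c1 (p q : O) : p * a = a * p -> q * a = a * q -> p * q * a = a * (p * q).
  by move=> pa qa; rewrite -mulrA qa mulrA pa mulrA.
have c2 (p q : O) : p * a = a * p -> q * a = a * q -> (p + q) * a = a * (p + q).
  by move=> pa qa; rewrite mulrDl mulrDr pa qa.
have yya := c1 _ _ ya ya.
by rewrite mulrBl mulrBr !(c1, c2).
Qed.

(* If h is self-adjoint and small then h + i (1 - h^2)^(1/2) is unitary, so its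
   image under f has norm 1; this bounds f without any spectral theory. *)
Lemma star_hom_bound (f : O -> O) : linear f -> {morph f : x y / x * y} ->
  {morph f : x / star x} -> f 1 = 1 -> forall x, nrm (f x) <= 2 * nrm x.
Proof.
move=> fL fM fS f1.
have fD : {morph f : x y / x + y}.
  by move=> x y; rewrite -(scale1r x) fL !scale1r.
have f0 : f 0 = 0 by apply: (addrI (f 0)); rewrite -fD !addr0.
have fZ a : {morph f : x / a *: x} by move=> x; rewrite -(addr0 (a *: x)) fL f0 addr0.
have small h : star h = h -> nrm h <= 4^-1 -> nrm (f h) <= 1.
  move=> hs h4.
  have hh8 : nrm (h * h) <= 8^-1.
    by have := nrmM h h; have := nrm_ge0 h; nra.
  pose Z : set O := [set y | star y = y] `&` [set y | forall a, [set h] a -> y * a = a * y].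
  have hhs : star (h * h) = h * h by rewrite star_mul hs.
  have hhh : h * h * h = h * (h * h) by rewrite mulrA.
  have [||y Zy|y [ys yh] yE] := @isqrt_exists (h * h) Z hh8.
  - move=> u l uZ ul; split; first by apply: tclosed_self ul => m; case: (uZ m).
    by apply: tclosed_commutant ul => m; case: (uZ m).
  - by split=> [|a ->]; [exact: star0|rewrite mul0r mulr0].
  - case: Zy => ys /(_ _ erefl) yh; split=> [|_ ->]; last exact: comm_isqrt_step.
    by apply: star_isqrt_step => //; rewrite mulrA yh -mulrA yh mulrA.
  have {}yh := yh _ erefl.
  have th := comm_1D yh; have eh := comm_1B (esym hhh).
  have te : (1 + y) * (1 - h * h) = (1 - h * h) * (1 + y).
    by apply: comm_1B; rewrite mulrA th -mulrA th mulrA.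
  (* Since [1 + y] is an inverse square root of [1 - h * h], this [k] is a square root of it. *)
  pose k := (1 + y) * (1 - h * h).
  have ks : star k = k by rewrite /k star_mul starB starD star1 hhs ys te.
  have kh : k * h = h * k by rewrite /k -[LHS]mulrA -eh [LHS]mulrA th -mulrA.
  have kk : k * k = 1 - h * h.
    by rewrite /k mulrA -(mulrA (1 + y)) -te mulrA yE mul1r.
  pose u := h + 'i%C *: k.
  have us : star u = h - 'i%C *: k.
    by rewrite starD starZ hs ks; congr (_ + _); rewrite -scaleNr; congr (_ *: _); simpc.
  have uu : star u * u = 1.
    rewrite us mulrDr mulrBl mulrBl -!scalerAl -!scalerAr scalerA -['i%C * _]expr2 sqr_i kk kh.
    rewrite scaleN1r; abel.
  have fu : nrm (f u) = 1.
    apply/eqP; rewrite -(@eqrXn2 _ 2) ?nrm_ge0 // -nrm_starM -fS -fM uu f1 nrm1.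
    by rewrite expr1n.
  have -> : f h = 2^-1 *: (f u + star (f u)).
    rewrite -fS -fD -fZ us /u; congr (f _).
    by rewrite addrACA subrr addr0 scaler_half.
  rewrite nrmZ nrmcV nrm_nat.
  by have := ler_nrmD (f u) (star (f u)); rewrite nrm_star fu; lra.
(* Rescaling [h] to norm 1/4 turns the bound 1 of [small] into the factor 4. *)
have sa h : star h = h -> nrm (f h) <= 4 * nrm h.
  move=> hs; have [->|h0] := eqVneq h 0; first by rewrite f0 !nrm0 mulr0.
  have nh := nrm_gt0 h0.
  pose c : R[i] := ((4 * nrm h)^-1)%:C%C.
  have cE : nrm c = (4 * nrm h)^-1.
    by rewrite nrm_real ger0_norm // invr_ge0 mulr_ge0 // ltW.
  have := @small (c *: h); rewrite fZ starZ hs conjc_real !nrmZ cE.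
  move/(_ erefl); rewrite invfM -mulrA mulVf ?gt_eqF // mulr1 lexx => /(_ isT).
  by rewrite -invfM mulrC ler_pdivrMr ?mul1r // mulr_gt0.
(* The C*-identity passes from the self-adjoint [star x * x] to [x], and the factor 4 becomes its
   square root 2. *)
move=> x; rewrite -(@ler_pXn2r _ 2) ?nnegrE ?mulr_ge0 ?nrm_ge0 // exprMn.
rewrite -!nrm_starM -fS -fM -natrX; apply: sa.
by rewrite star_mul starK.
Qed.

End InverseSquareRoot.

(** * The unit as an extreme point, and orthogonality of the generating isometries *)

Section Extreme.
Context {R : realType} {O : cstarAlgType R}.
Implicit Types (w : O).

Definition sign_mean (a m : R[i]) : {poly R[i]} :=
  (a ^+ 2 + m)%:P + (2 * a * m)%:P * 'X + (m * (m - 1))%:P * 'X ^+ 2.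

(** Averaging over one more sign [e], which shifts [a] by [e] and contributes the factor
    [1 + e 'X]. *)
Lemma sign_mean_step a m : sign_mean a (m + 1) =
  2^-1%:P * ((1 + 'X) * sign_mean (a + 1) m + (1 - 'X) * sign_mean (a - 1) m).
Proof.
apply: (@mulfI _ (2%:P)); first by rewrite polyC_eq0 pnatr_eq0.
rewrite mulrA -polyCM mulfV ?pnatr_eq0 // polyC1 mul1r /sign_mean.
rewrite !expr2 !(polyCD, polyCB, polyCM, polyCN, polyC1).
by ring.
Qed.

(* sign_mean c N at w is the mean of (c + e_1 + .. + e_N)^2 (1 + e_1 w) ..
   (1 + e_N w) over all signs e_i, hence an average of contractions with total
   mass c^2 + N. *)
Lemma nrm_sign_mean w (N : nat) (c : R) : nrm (1 + w) <= 1 -> nrm (1 - w) <= 1 ->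
  nrm (horner_alg w (sign_mean c%:C%C N%:R)) <= c ^+ 2 + N%:R.
Proof.
move=> wp wm; elim: N c => [|N IH] c.
  rewrite /sign_mean !mulr0n mulr0 !mul0r. rewrite !addr0.
  by rewrite horner_algC nrmA -rmorphXn nrm_real ger0_norm ?sqr_ge0.
have cp : c%:C%C + 1 = (c + 1)%:C%C by rewrite rmorphD rmorph1.
have cm : c%:C%C - 1 = (c - 1)%:C%C by rewrite rmorphB rmorph1.
rewrite -natr1 sign_mean_step cp cm; move: (IH (c + 1)) (IH (c - 1)).
move: (sign_mean _ _) (sign_mean _ _) => p q.
rewrite rmorphM rmorphD !rmorphM rmorphD rmorphB /= !rmorph1 !horner_algX.
rewrite horner_algC -scalerAl mul1r nrmZ nrmcV nrm_nat.
move: (horner_alg w p) (horner_alg w q) => x y yc xc.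
have := nrmM (1 + w) y; have := nrmM (1 - w) x.
have := ler_nrmD ((1 + w) * y) ((1 - w) * x).
have := nrm_ge0 x; have := nrm_ge0 y => y0 x0 h1 h2 h3.
have k1 : nrm (1 + w) * nrm y <= nrm y by rewrite ler_piMl.
have k2 : nrm (1 - w) * nrm x <= nrm x by rewrite ler_piMl.
lra.
Qed.

(** For [c = 0] the mean is [N + N (N - 1) w^2], of norm at most [N], so [|w^2| <= 2 / (N - 1)] for
    arbitrarily large [N]. Here [N - 1] is a power of 2. *)
Lemma one_extreme_point w : star w = w -> nrm (1 + w) <= 1 -> nrm (1 - w) <= 1 -> w = 0.
Proof.
move=> ws wp wm; apply: nrm_eq0; apply/eqP; rewrite -sqrf_eq0; apply/eqP.
rewrite -nrm_starM ws; apply/eqP; rewrite eq_le nrm_ge0 andbT.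
apply/ler_addgt0Pr => e e0; rewrite add0r.
have [M HM] := half_pow_small (divr_gt0 e0 (ltr0n _ 2)).
pose N := (2 ^ M).+1.
have := @nrm_sign_mean w N 0 wp wm; rewrite rmorph0 /sign_mean expr0n add0r mulr0 mul0r.
rewrite polyC0 mul0r addr0 expr0n add0r rmorphD rmorphM rmorphXn /= horner_algX !horner_algC expr2.
rewrite -scalerAl mul1r /N -natr1 addrK natrX => H.
have a0 : 0 < 2 ^+ M :> R by rewrite exprn_gt0.
set a : R[i] := 2 ^+ M in H.
have aE : nrm a = 2 ^+ M by rewrite /a -natrX nrm_nat natrX.
have bE : nrm (a + 1) = 2 ^+ M + 1 by rewrite /a -natrX natr1 nrm_nat -natr1 natrX.
have := ler_nrmB ((a + 1)%:A + ((a + 1) * a) *: (w * w)) ((a + 1)%:A).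
rewrite addrAC subrr add0r nrmZ nrmA nrmcM aE bE => K.
have {K} : (2 ^+ M + 1) * (2 ^+ M * nrm (w * w)) <= (2 ^+ M + 1) * 2.
  by rewrite mulrA mulrDr mulr1; move: H; rewrite -natr1 natrX; lra.
rewrite ler_pM2l ?addr_gt0 // -ler_pdivlMl // -exprVn => K.
by apply: le_trans K _; move: HM; rewrite ler_pdivlMr.
Qed.

(** A substitute for the fact that positive elements of sum 0 vanish. With [m] indices, both
    [1 + a k / m] and [1 - a k / m] are averages of copies of 1 and of contractions [1 - a j], so
    [one_extreme_point] applies to [a k / m]. *)
Lemma sum_eq0_contractions (I : finType) (P : pred I) (a : I -> O) k :
  (forall j, P j -> star (a j) = a j) -> (forall j, P j -> nrm (1 - a j) <= 1) ->
  \sum_(j | P j) a j = 0 -> P k -> a k = 0.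
Proof.
move=> as_ a1 a0 Pk.
pose m : R := (#|P|)%:R.
have m0 : 0 < m by rewrite ltr0n; apply/card_gt0P; exists k.
have nmV : nrm ((m^-1)%:C%C : R[i]) = m^-1 by rewrite nrm_real ger0_norm // invr_ge0 ltW.
have mE : (#|[pred j | P j && (j != k)]|)%:R = m - 1.
  rewrite /m (cardD1 k P) [k \in P]Pk /= -natr1 addrK; congr (_%:R).
  by apply: eq_card => j; rewrite !inE andbC.
have mC : (m^-1)%:C%C *: ((m - 1)%:C%C%:A + 1) = 1 :> O.
  rewrite -[X in _ + X]scale1r -scalerDl -(rmorph1 (real_complex R)) -rmorphD subrK.
  by rewrite scalerA -rmorphM mulVf ?gt_eqF // rmorph1 scale1r.
have m1 : 0 <= m - 1 by rewrite -mE ler0n.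
pose w := (m^-1)%:C%C *: a k.
suff w0 : w = 0.
  move/eqP: w0; rewrite scaler_eq0 => /orP[|/eqP//].
  by rewrite (fmorph_eq0 (real_complex R)) invr_eq0 gt_eqF.
apply: one_extreme_point; first by rewrite starZ conjc_real as_.
- have -> : 1 + w = (m^-1)%:C%C *: (1 + \sum_(j | P j && (j != k)) (1 - a j)).
    move: a0; rewrite (bigD1 k) //= => /eqP; rewrite addr_eq0 => /eqP akE.
    rewrite sumrB -[X in _ - X]opprK -akE opprK sumr_const -[LHS]/(1 + w) /w.
    rewrite addrA scalerDr; congr (_ + _); rewrite -[LHS]mC; congr (_ *: _).
    by rewrite addrC; congr (_ + _); rewrite -mE rmorph_nat scaler_nat.
  rewrite nrmZ nmV mulrC ler_pdivrMr // mul1r.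
  apply: le_trans (ler_nrmD _ _) _; rewrite nrm1 -lerBrDl.
  apply: le_trans (ler_nrm_sum _ _ _) _; rewrite -mE -sumr_const.
  by apply: ler_sum => j /andP[Pj _]; apply: a1.
- have -> : 1 - w = (m^-1)%:C%C *: ((m - 1)%:C%C%:A + (1 - a k)).
    by rewrite addrA scalerBr mC.
  rewrite nrmZ nmV mulrC ler_pdivrMr // mul1r.
  apply: le_trans (ler_nrmD _ _) _; rewrite nrmA nrm_real ger0_norm //.
  by have := a1 _ Pk; lra.
Qed.

(** Compressing [\sum_k S k * star (S k) = 1] by [S j] gives 1 on both sides once the term [k = j]
    is taken out, so the remaining compressions [a k] have sum 0. Each [1 - a k] is the compression
    of a projection, hence a contraction. *)
Lemma isometries_orthogonal (n : nat) (S : 'I_n -> O) :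
  (forall i, star (S i) * S i = 1) -> \sum_(i < n) S i * star (S i) = 1 ->
  forall i j, star (S i) * S j = (i == j)%:R.
Proof.
move=> S1 Ssum i j; have [<-|ij] := eqVneq i j; first exact: S1.
pose a k := star (S j) * (S k * star (S k)) * S j.
have : a i = 0.
  apply: (@sum_eq0_contractions _ (fun k => k != j)) => // [k _|k _|].
  - by rewrite /a !star_mul !starK !mulrA.
  - have -> : 1 - a k = star (S j) * (1 - S k * star (S k)) * S j.
      by rewrite mulrBr mulrBl mulr1 S1.
    pose p := 1 - S k * star (S k).
    have pp : star p * p = p.
      rewrite /p starB star1 star_mul starK mulrBl !mulrBr !mul1r mulr1.
      by rewrite mulrA -(mulrA (S k)) S1 mulr1 subrr subr0.
    have p1 : nrm p <= 1.
      have := nrm_starM p; rewrite pp; have := nrm_ge0 p.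
      by move: (nrm p) => x; nra.
    have Sj : nrm (S j) = 1.
      apply/eqP; rewrite -(@eqrXn2 _ 2) ?nrm_ge0 // -nrm_starM S1 nrm1.
      by rewrite expr1n.
    rewrite -/p; have := nrmM (star (S j) * p) (S j); have := nrmM (star (S j)) p.
    by rewrite nrm_star Sj mul1r mulr1; lra.
  - have : star (S j) * 1 * S j = 1 by rewrite mulr1 S1.
    rewrite -Ssum mulr_sumr mulr_suml (bigD1 j) //= -/(a j) {1}/a.
    rewrite mulrA S1 mul1r S1 => /eqP; rewrite -subr_eq0 addrAC.
    by rewrite -[X in X - _]Ssum subrr add0r => /eqP.
move=> ai; apply: nrm_eq0; apply/eqP; rewrite -sqrf_eq0 -nrm_starM.
by rewrite star_mul starK mulrA -(mulrA (star _)) -/(a i) ai nrm0.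
Qed.

End Extreme.

(** * Spectral subspaces of the gauge action *)

Section Gauge.
Context {R : realType} {O : cstarAlgType R} (n : nat) (S : 'I_n -> O).
Context (gam : R[i] -> O -> O).
Hypotheses (hO : is_cuntz_algebra S) (hgam : is_gauge_action S gam).
Implicit Types (x y : O) (c z : R[i]).

Lemma isometryS i : star (S i) * S i = 1. Proof. by case: hO. Qed.

Lemma sum_range : \sum_(i < n) S i * star (S i) = 1. Proof. by case: hO. Qed.

Lemma orthS i j : star (S i) * S j = (i == j)%:R.
Proof. exact: isometries_orthogonal isometryS sum_range i j. Qed.

Lemma nrmS i : nrm (S i) = 1.
Proof.
apply/eqP; rewrite -(@eqrXn2 _ 2) ?nrm_ge0 // -nrm_starM isometryS nrm1.
by rewrite expr1n.
Qed.

Lemma expandl x : x = \sum_(i < n) S i * (star (S i) * x).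
Proof.
under eq_bigr do rewrite mulrA.
by rewrite -mulr_suml sum_range mul1r.
Qed.

Lemma expandr x : x = \sum_(i < n) (x * S i) * star (S i).
Proof.
under eq_bigr do rewrite -mulrA.
by rewrite -mulr_sumr sum_range mulr1.
Qed.

Section Automorphism.
Variable z : R[i].
Hypothesis z1 : `|z| = 1.

Lemma gam_linear : linear (gam z). Proof. by case: hgam => /(_ _ z1)[]. Qed.

Lemma gamM : {morph gam z : x y / x * y}. Proof. by case: hgam => /(_ _ z1)[]. Qed.

Lemma gam_star : {morph gam z : x / star x}. Proof. by case: hgam => /(_ _ z1)[]. Qed.

Lemma gamD : {morph gam z : x y / x + y}.
Proof. by move=> x y; rewrite -(scale1r x) gam_linear !scale1r. Qed.

Lemma gam0 : gam z 0 = 0.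
Proof. by apply: (addrI (gam z 0)); rewrite -gamD !addr0. Qed.

Lemma gamZ c : {morph gam z : x / c *: x}.
Proof. by move=> x; rewrite -(addr0 (c *: x)) gam_linear gam0 addr0. Qed.

Lemma gamN : {morph gam z : x / - x}.
Proof. by move=> x; rewrite -scaleN1r gamZ scaleN1r. Qed.

Lemma gamB : {morph gam z : x y / x - y}.
Proof. by move=> x y; rewrite gamD gamN. Qed.

Lemma gam1 : gam z 1 = 1.
Proof.
have [[g _ gK] _ _ _] : is_star_automorphism (gam z) by case: hgam => /(_ _ z1).
by rewrite -[LHS]mulr1 -{2}(gK 1) -gamM mul1r gK.
Qed.

(** The gauge automorphisms are given by algebraic conditions; this is where their continuity comes
    from. A constant 2 in place of 1 is enough for all the limits below. *)
Lemma nrm_gam x : nrm (gam z x) <= 2 * nrm x.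
Proof. exact: star_hom_bound gam_linear gamM gam_star gam1 x. Qed.

Lemma unit_neq0 : z != 0.
Proof. by rewrite -normr_eq0 z1 oner_neq0. Qed.

Lemma nrm_unitX (k : int) : nrm (z ^ k) = 1.
Proof.
apply: nrm_eq1; case: k => k.
all: by rewrite ?NegzE /= ?exprnN ?normfV normrX z1 expr1n ?invr1.
Qed.

Lemma conjc_unitX (k : int) : ((z ^ k)^*)%C = z ^ (- k).
Proof. by rewrite conjc_nrm1 ?nrm_unitX // invr_expz. Qed.

End Automorphism.

(** The spectral subspace of degree [k], wrapped in a record so that it stays opaque to
    unification. *)
Record homog (k : int) (x : O) : Prop := MkHomog {
  homogE : forall z, `|z| = 1 -> gam z x = z ^ k *: x }.

Lemma homog_fixed : homog 0 = gauge_fixed gam.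
Proof.
apply/seteqP; split=> x => [[xk] z z1|xk]; first by rewrite xk // expr0z scale1r.
by split=> z z1; rewrite xk // expr0z scale1r.
Qed.

Lemma homog0 k : homog k 0.
Proof. by split=> z z1; rewrite gam0 // scaler0. Qed.

Lemma homogD k x y : homog k x -> homog k y -> homog k (x + y).
Proof. by move=> [xk] [yk]; split=> z z1; rewrite gamD // xk // yk // scalerDr. Qed.

Lemma homogZ k c x : homog k x -> homog k (c *: x).
Proof. by move=> [xk]; split=> z z1; rewrite gamZ // xk // !scalerA mulrC. Qed.

Lemma homogN k x : homog k x -> homog k (- x).
Proof. by move=> xk; rewrite -scaleN1r; exact: homogZ. Qed.

Lemma homogB k x y : homog k x -> homog k y -> homog k (x - y).
Proof. by move=> xk yk; apply: homogD => //; exact: homogN. Qed.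

Lemma homog_sum k (I : Type) (r : seq I) (P : pred I) (F : I -> O) :
  (forall i, P i -> homog k (F i)) -> homog k (\sum_(i <- r | P i) F i).
Proof. by move=> H; elim/big_ind: _ => //; [exact: homog0|exact: homogD]. Qed.

Lemma homogM k l x y : homog k x -> homog l y -> homog (k + l) (x * y).
Proof.
move=> [xk] [yl]; split=> z z1; rewrite gamM // xk // yl // expfzDr ?unit_neq0 //.
by rewrite -scalerAl -scalerAr scalerA.
Qed.

Lemma homog_star k x : homog k x -> homog (- k) (star x).
Proof.
by move=> [xk]; split=> z z1; rewrite gam_star // xk // starZ conjc_unitX.
Qed.

Lemma homog1 : homog 0 1.
Proof. by split=> z z1; rewrite gam1 // expr0z scale1r. Qed.

Lemma homogS i : homog 1 (S i).
Proof. by case: hgam => _ _ _ gS; split=> z z1; rewrite gS. Qed.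

Lemma tclosed_homog k : tclosed (homog k).
Proof.
move=> u l uh ul; split=> z z1; apply: (tends_unique (u := fun m => gam z (u m))).
  apply: (ler_nrm_bound (C := 2)) ul => // x y.
  by rewrite -gamB // nrm_gam.
under [X in tends X]eq_fun => m do rewrite (homogE (uh m)) //.
exact: tendsZ.
Qed.

Fixpoint gright b x : Prop :=
  if b is b'.+1 then forall j, gright b' (x * S j) else exists c, x = c%:A.

(* gword a b is the span of the products S_m S_w^* of words m of length a and
   w of length b: the products S_m^* x S_w are all scalars. *)
Fixpoint gword a b x : Prop :=
  if a is a'.+1 then forall i, gword a' b (star (S i) * x) else gright b x.

Lemma gwordSr a b x : gword a b.+1 x <-> forall j, gword a b (x * S j).
Proof.
elim: a x => [//|a IH] x /=; split=> H j => [i|]; first by rewrite mulrA; move: (H i) => /IH; apply.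
by apply/IH => i; rewrite -mulrA; apply: H.
Qed.

Lemma gword_lin a b c x y : gword a b x -> gword a b y -> gword a b (c *: x + y).
Proof.
have r d : forall u v, gright d u -> gright d v -> gright d (c *: u + v).
  elim: d => [|d IH] u v /=.
    by move=> [e ->] [f ->]; exists (c * e + f); rewrite scalerA scalerDl.
  by move=> hu hv j; rewrite mulrDl -scalerAl; apply: IH.
elim: a x y => [|a IH] x y /=; first exact: r.
by move=> hx hy i; rewrite mulrDr -scalerAr; apply: IH.
Qed.

Lemma gword0 a b : gword a b 0.
Proof.
elim: a => [|a IH] /= => [|i]; last by rewrite mulr0.
elim: b => [|b IH] /= => [|i]; last by rewrite mul0r.
by exists 0; rewrite scale0r.
Qed.

Lemma gwordD a b x y : gword a b x -> gword a b y -> gword a b (x + y).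
Proof. by rewrite -{2}(scale1r x); exact: gword_lin. Qed.

Lemma gwordZ a b c x : gword a b x -> gword a b (c *: x).
Proof. by move=> hx; rewrite -(addr0 (_ *: _)); apply: gword_lin => //; exact: gword0. Qed.

Lemma gword_sum a b (I : Type) (r : seq I) (P : pred I) (F : I -> O) :
  (forall i, P i -> gword a b (F i)) -> gword a b (\sum_(i <- r | P i) F i).
Proof. by move=> H; elim/big_ind: _ => //; [exact: gword0|exact: gwordD]. Qed.

(** This is [S_m S_w^* = \sum_i S_m S_i S_i^* S_w^*], the inclusion of one matrix level in the next.
    In the dual description by scalar entries it rests on the orthogonality of the ranges. *)
Lemma gword_widen k a b x : gword a b x -> gword (k + a) (k + b) x.
Proof.
move=> H; elim: k => // k; rewrite !addSn; move: (k + a)%N (k + b)%N => {H}a {}b.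
elim: a x => [|a IH] x H; last by move=> i; apply: IH.
elim: b x H => [|b IH] x H; last by apply/gwordSr => j; apply: IH.
case: H => c -> i j; exists (c * (i == j)%:R).
by rewrite -scalerAr mulr1 -scalerAl orthS -scaler_nat scalerA.
Qed.

Lemma gwordM a b d x y : gword a b x -> gword b d y -> gword a d (x * y).
Proof.
elim: b x y => [|b IH] x y.
  elim: a x => [|a IH] x hx hy; first by case: hx => c ->; rewrite mulr_algl; exact: gwordZ.
  by move=> i; rewrite mulrA; apply: IH => //; exact: hx.
move=> /gwordSr hx hy; rewrite (expandr x) mulr_suml; apply: gword_sum => j _.
by rewrite -mulrA; apply: IH; [exact: hx|exact: hy].
Qed.

Lemma gword_star a b x : gword a b x -> gword b a (star x).
Proof.
elim: a x => [|a IH] x.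
  elim: b x => [|b IH] x; last by move=> H i; rewrite -star_mul; apply/IH/H.
  by move=> [c ->]; exists (c^*)%C; rewrite starZ star1.
by move=> H; apply/gwordSr => j; rewrite -{1}(starK (S j)) -star_mul; apply/IH/H.
Qed.

Lemma gword_homog a b x : gword a b x -> homog (a%:Z - b%:Z) x.
Proof.
elim: a x => [|a IH] x.
  elim: b x => [|b IH] x; first by move=> [c ->]; apply/homogZ/homog1.
  move=> H; rewrite (expandr x); apply: homog_sum => j _.
  have -> : 0%:Z - b.+1%:Z = (0%:Z - b%:Z) - 1 by lia.
  by apply: homogM; [exact/IH/H|exact/homog_star/homogS].
move=> H; rewrite (expandl x); apply: homog_sum => j _.
have -> : a.+1%:Z - b%:Z = 1 + (a%:Z - b%:Z) by lia.
by apply: homogM; [exact: homogS|exact/IH/H].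
Qed.

Lemma gwordS i : gword 1 0 (S i).
Proof. by move=> j; exists (j == i)%:R; rewrite orthS scaler_nat. Qed.

Inductive wpoly : O -> Prop :=
  | wpolyW a b x of gword a b x : wpoly x
  | wpolyD x y of wpoly x & wpoly y : wpoly (x + y).

Lemma wpolyZ c x : wpoly x -> wpoly (c *: x).
Proof.
elim=> [a b {}x /(gwordZ c)/wpolyW //|{}x y _ cx _ cy].
by rewrite scalerDr; exact: wpolyD.
Qed.

Lemma wpoly_star x : wpoly x -> wpoly (star x).
Proof.
elim=> [a b {}x /gword_star/wpolyW //|{}x y _ cx _ cy].
by rewrite starD; exact: wpolyD.
Qed.

Lemma wpolyM x y : wpoly x -> wpoly y -> wpoly (x * y).
Proof.
move=> hx hy; elim: hx => [a b {}x hx|{}x x' _ h _ h']; last by rewrite mulrDl; exact: wpolyD.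
elim: hy => [c d {}y hy|{}y y' _ h _ h']; last by rewrite mulrDr; exact: wpolyD.
(* Both factors are lengthened until their inner words have the common length [c + b]. *)
apply: (@wpolyW (c + a) (b + d)); apply: (@gwordM _ (c + b)); first exact: gword_widen.
by rewrite (addnC c); exact: gword_widen.
Qed.

(** The closure of the word polynomials is a C*-subalgebra containing every [S i], so the generation
    clause of [is_cuntz_algebra] makes it everything. *)
Lemma wpoly_dense x (e : R) : 0 < e -> exists2 p, wpoly p & nrm (x - p) <= e.
Proof.
pose D : set O := [set x | forall e : R, 0 < e -> exists2 p, wpoly p & nrm (x - p) <= e].
have Dc : closed D.
  move=> y Dy {}e e0; have e2 : 0 < e / 2 by rewrite divr_gt0.
  have eC : 0 < (e / 2)%:C%C :> R[i] by rewrite ltcR.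
  have [w [Dw]] := Dy _ (nbhsx_ballx y _ eC).
  rewrite -ball_normE /= nrmE ltcR => yw; have [p wp pw] := Dw _ e2.
  exists p => //; rewrite (splitr e); apply: le_trans (ler_nrm_dist y w p) _.
  by apply: lerD => //; exact: ltW.
have pD p : wpoly p -> D p by move=> wp {}e e0; exists p; rewrite // subrr nrm0 ltW.
have DD y w : D y -> D w -> D (y + w).
  move=> Dy Dw {}e e0; have e2 : 0 < e / 2 by rewrite divr_gt0.
  have [p wp pe] := Dy _ e2; have [q wq qe] := Dw _ e2.
  exists (p + q); first exact: wpolyD.
  by rewrite opprD addrACA (splitr e); apply: le_trans (ler_nrmD _ _) (lerD pe qe).
have DZ c y : D y -> D (c *: y).
  move=> Dy {}e e0; have c0 : 0 < nrm c + 1 by rewrite ltr_wpDl ?nrm_ge0.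
  have [p wp pe] := Dy _ (divr_gt0 e0 c0); exists (c *: p); first exact: wpolyZ.
  rewrite -scalerBr nrmZ; move: pe; rewrite ler_pdivlMr //; apply: le_trans.
  by rewrite mulrC ler_wpM2l ?nrm_ge0 // lerDl.
have DM y w : D y -> D w -> D (y * w).
  move=> Dy Dw {}e e0; have e2 : 0 < e / 2 by rewrite divr_gt0.
  have w0 : 0 < nrm w + 1 by rewrite ltr_wpDl ?nrm_ge0.
  have [p wp pe] := Dy _ (divr_gt0 e2 w0).
  have p0 : 0 < nrm p + 1 by rewrite ltr_wpDl ?nrm_ge0.
  have [q wq qe] := Dw _ (divr_gt0 e2 p0).
  exists (p * q); first exact: wpolyM.
  have -> : y * w - p * q = (y - p) * w + p * (w - q).
    by rewrite mulrBl mulrBr addrA subrK.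
  apply: le_trans (ler_nrmD _ _) _; rewrite (splitr e).
  rewrite (ler_pdivlMr _ _ w0) in pe; rewrite (ler_pdivlMr _ _ p0) in qe; apply: lerD.
    apply: le_trans (nrmM _ _) _; apply: le_trans pe.
    by rewrite ler_wpM2l ?nrm_ge0 // lerDl.
  apply: le_trans (nrmM _ _) _; apply: le_trans qe.
  by rewrite mulrC ler_wpM2l ?nrm_ge0 // lerDl.
have DS y : D y -> D (star y).
  move=> Dy {}e e0; have [p wp pe] := Dy _ e0; exists (star p); first exact: wpoly_star.
  by rewrite -starB nrm_star.
have D0 : D 0 by apply: pD; apply: (@wpolyW 0 0); exact: gword0.
have [_ _ /(_ (CStarSub Dc D0 DD DZ DM DS) (fun i => pD _ (wpolyW (gwordS i))))] := hO.
by move=> /seteqP[_ /(_ x I)] /=; apply.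
Qed.

End Gauge.

(** * Fourier coefficients *)

Section RootsOfUnity.
Context {R : realType}.

(** A primitive root of unity of order [2 ^ m.+1], obtained by taking square roots of -1
    repeatedly. *)
Definition dyroot (m : nat) : R[i] := iter m (@sqrtc R) (-1).

Lemma dyrootX m : dyroot m ^+ (2 ^ m) = -1.
Proof.
by elim: m => [|m IH]; rewrite ?expr1 // expnS exprM /= sqr_sqrtc.
Qed.

Lemma dyroot_prim m : (2 ^ m.+1).-primitive_root (dyroot m).
Proof.
have w1 : dyroot m ^+ (2 ^ m.+1) = 1.
  by rewrite expnS mulnC exprM dyrootX expr2 mulrNN mulr1.
have [d dp /(dvdn_pfactor _ _ (isT : prime 2))[j jm dE]] := prim_order_exists (expn_gt0 2 m.+1) w1.
move: jm; rewrite leq_eqVlt => /orP[/eqP <-|jm]; first by rewrite -dE.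
have : (d %| 2 ^ m)%N by rewrite dE dvdn_exp2l // -ltnS.
by rewrite (prim_order_dvd dp) dyrootX eq_sym -addr_eq0 -mulr2n pnatr_eq0.
Qed.

Lemma dyroot_unit m j : `|dyroot m ^+ j| = 1.
Proof.
rewrite normrX; suff -> : `|dyroot m| = 1 by rewrite expr1n.
apply/eqP; rewrite -(@pexpr_eq1 _ _ (2 ^ m.+1)) ?normr_ge0 // -?normrX.
  by rewrite (prim_expr_order (dyroot_prim m)) normr1.
by rewrite expn_gt0.
Qed.

Lemma sum_dyroot m (d : int) : (`|d| < 2 ^ m.+1)%N ->
  \sum_(j < 2 ^ m.+1) (dyroot m ^+ j) ^ d = (2 ^ m.+1)%:R *+ (d == 0).
Proof.
move=> dm; have [->|d0] := eqVneq d 0.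
  rewrite (eq_bigr (fun=> 1)); first by rewrite sumr_const card_ord.
  by move=> j _; rewrite expr0z.
have qj (j : nat) : (dyroot m ^+ j) ^ d = (dyroot m ^ d) ^+ j.
  by rewrite !exprnP !exprz_exp mulrC.
under eq_bigr do rewrite qj.
have q1 : dyroot m ^ d != 1.
  have H k : (0 < k < 2 ^ m.+1)%N -> dyroot m ^+ k != 1.
    by case/andP=> k0 km; rewrite -(prim_order_dvd (dyroot_prim m)) gtnNdvd.
  case: d d0 dm {qj} => k d0 km; first by apply: H; rewrite lt0n d0.
  by rewrite NegzE -exprnN invr_eq1; apply: H.
apply: (@mulfI _ (dyroot m ^ d - 1)); first by rewrite subr_eq0.
by rewrite -subrX1 -qj (prim_expr_order (dyroot_prim m)) exp1rz subrr mulr0.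
Qed.

End RootsOfUnity.

Section Fourier.
Context {R : realType} {O : cstarAlgType R} (n : nat) (S : 'I_n -> O).
Context (gam : R[i] -> O -> O).
Hypotheses (hO : is_cuntz_algebra S) (hgam : is_gauge_action S gam).
Implicit Types (x y : O) (c z : R[i]) (k : int).
Local Notation homog := (homog gam).

Definition fourier k m x : O :=
  (2 ^ m.+1)%:R^-1 *: \sum_(j < 2 ^ m.+1) (dyroot m ^+ j) ^ (- k) *: gam (dyroot m ^+ j) x.

Lemma fourierD k m x y : fourier k m (x + y) = fourier k m x + fourier k m y.
Proof.
rewrite -scalerDr -big_split; congr (_ *: _); apply: eq_bigr => j _.
by rewrite (gamD hgam) ?dyroot_unit // scalerDr.
Qed.

Lemma fourierN k m x : fourier k m (- x) = - fourier k m x.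
Proof.
rewrite -scalerN -sumrN; congr (_ *: _); apply: eq_bigr => j _.
by rewrite (gamN hgam) ?dyroot_unit // scalerN.
Qed.

Lemma fourierB k m x y : fourier k m (x - y) = fourier k m x - fourier k m y.
Proof. by rewrite fourierD fourierN. Qed.

Lemma fourierMl k (l : int) m a x : homog l a -> fourier k m (a * x) = a * fourier (k - l) m x.
Proof.
move=> al; rewrite -scalerAr mulr_sumr; congr (_ *: _); apply: eq_bigr => j _.
have u := @dyroot_unit R m j.
rewrite (gamM hgam) // (homogE al) // -scalerAr -scalerAl scalerA -expfzDr ?(unit_neq0 u) //.
by congr (_ ^ _ *: _); lia.
Qed.

Lemma fourierMr k (l : int) m a x : homog l a -> fourier k m (x * a) = fourier (k - l) m x * a.
Proof.
move=> al; rewrite -scalerAl mulr_suml; congr (_ *: _); apply: eq_bigr => j _.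
have u := @dyroot_unit R m j.
rewrite (gamM hgam) // (homogE al) // -scalerAl -scalerAr scalerA -expfzDr ?(unit_neq0 u) //.
by congr (_ ^ _ *: _); lia.
Qed.

Lemma fourier_star k m x : fourier k m (star x) = star (fourier (- k) m x).
Proof.
rewrite starZ conjc_inv conjc_nat star_sum; congr (_ *: _); apply: eq_bigr => j _.
have u := @dyroot_unit R m j.
by rewrite (gam_star hgam) // starZ conjc_unitX // opprK.
Qed.

Lemma nrm_fourier k m x : nrm (fourier k m x) <= 2 * nrm x.
Proof.
rewrite nrmZ nrmcV nrm_nat ler_pdivrMl ?ltr0n ?expn_gt0 //.
apply: le_trans (ler_nrm_sum _ _ _) _.
have -> : (2 ^ m.+1)%:R * (2 * nrm x) = \sum_(j < 2 ^ m.+1) 2 * nrm x.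
  by rewrite sumr_const card_ord mulr_natl.
 apply: ler_sum => j _.
have u := @dyroot_unit R m j.
by rewrite nrmZ nrm_unitX // mul1r (nrm_gam hgam).
Qed.

Lemma fourier_homog k (l : int) m x : homog l x -> (`|(l - k)%R| < 2 ^ m.+1)%N ->
  fourier k m x = x *+ (l == k).
Proof.
move=> xl lk; rewrite /fourier.
rewrite (eq_bigr (fun j : 'I__ => (dyroot m ^+ j) ^ (l - k) *: x)); last first.
  move=> j _; have u := @dyroot_unit R m j.
  by rewrite (homogE xl) // scalerA -expfzDr ?(unit_neq0 u) // addrC.
rewrite -scaler_suml sum_dyroot // subr_eq0 scalerA mulrnAr mulVf ?pnatr_eq0 -?lt0n ?expn_gt0 //.
by rewrite scaler_nat.
Qed.

(** Averaging over roots of unity confuses only degrees that are congruent modulo [2 ^ m.+1], so on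
    a finite sum of words the averages are eventually constant. Density and the uniform bound
    [nrm_fourier] then give convergence everywhere. *)
Lemma fourier_wpoly k x : wpoly S x -> exists M l, forall m, (M <= m)%N -> fourier k m x = l.
Proof.
elim=> [a b {}x /(gword_homog hO hgam) xh|{}x y _ [M [l H]] _ [M' [l' H']]].
  exists `|(a%:Z - b%:Z - k)%R|%N, (x *+ (a%:Z - b%:Z == k)) => m Mm.
  apply: fourier_homog xh _; apply: leq_ltn_trans Mm _.
  by rewrite (ltn_trans (ltnSn m)) // ltn_expl.
exists (maxn M M'), (l + l') => m; rewrite geq_max => /andP[/H <- /H' <-].
exact: fourierD.
Qed.

Lemma fourier_tends k x : exists l, tends (fun m => fourier k m x) l.
Proof.
apply: nrm_cauchy_tends => e e0; have e4 : 0 < e / 4 by rewrite divr_gt0.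
have [p wp xp] := wpoly_dense hO x e4; have [M [l H]] := fourier_wpoly k wp.
exists M => m m' /H mE /H m'E.
have := nrm_fourier k m (x - p); have := nrm_fourier k m' (x - p).
rewrite !fourierB mE m'E (nrmBC _ l).
have := ler_nrm_dist (fourier k m x) l (fourier k m' x); rewrite (nrmBC l); lra.
Qed.

Definition fcoef k x : O := sval (cid (fourier_tends k x)).

Lemma fcoefP k x : tends (fun m => fourier k m x) (fcoef k x).
Proof. by rewrite /fcoef; case: cid. Qed.

Lemma fcoefD k x y : fcoef k (x + y) = fcoef k x + fcoef k y.
Proof.
apply: (tends_unique (fcoefP _ _)); apply: tends_ext (tendsD (fcoefP _ _) (fcoefP _ _)).
by move=> m; rewrite fourierD.
Qed.

Lemma fcoefN k x : fcoef k (- x) = - fcoef k x.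
Proof.
apply: (tends_unique (fcoefP _ _)); have := tendsZ (-1) (fcoefP k x).
by rewrite scaleN1r; apply: tends_ext => m; rewrite fourierN scaleN1r.
Qed.

Lemma fcoefB k x y : fcoef k (x - y) = fcoef k x - fcoef k y.
Proof. by rewrite fcoefD fcoefN. Qed.

Lemma fcoef0 k : fcoef k 0 = 0.
Proof. by apply: (addrI (fcoef k 0)); rewrite -fcoefD !addr0. Qed.

Lemma fcoef_sum k (I : Type) (r : seq I) (P : pred I) (F : I -> O) :
  fcoef k (\sum_(i <- r | P i) F i) = \sum_(i <- r | P i) fcoef k (F i).
Proof. exact: (big_morph _ (fcoefD k) (fcoef0 k)). Qed.

Lemma fcoefMl k (l : int) a x : homog l a -> fcoef k (a * x) = a * fcoef (k - l) x.
Proof.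
move=> al; apply: (tends_unique (fcoefP _ _)).
by apply: tends_ext (tendsMl _ (fcoefP _ _)) => m; rewrite (fourierMl _ _ _ al).
Qed.

Lemma fcoefMr k (l : int) a x : homog l a -> fcoef k (x * a) = fcoef (k - l) x * a.
Proof.
move=> al; apply: (tends_unique (fcoefP _ _)).
by apply: tends_ext (tendsMr _ (fcoefP _ _)) => m; rewrite (fourierMr _ _ _ al).
Qed.

Lemma fcoef_star k x : fcoef k (star x) = star (fcoef (- k) x).
Proof.
apply: (tends_unique (fcoefP _ _)).
by apply: tends_ext (tends_star (fcoefP _ _)) => m; rewrite fourier_star.
Qed.

Lemma nrm_fcoef k x : nrm (fcoef k x) <= 2 * nrm x.
Proof. by apply: tends_nrm (fcoefP k x) _ => m; exact: nrm_fourier. Qed.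

Lemma fcoef_homog k (l : int) x : homog l x -> fcoef k x = x *+ (l == k).
Proof.
move=> xl; apply: (tends_unique (fcoefP _ _)).
apply: (@tends_ev _ _ _ _ `|(l - k)%R|%N) => m lm; apply: fourier_homog xl _.
by apply: leq_ltn_trans lm _; rewrite (ltn_trans (ltnSn m)) // ltn_expl.
Qed.

Lemma homog_fcoef k x : homog k (fcoef k x).
Proof.
apply: (tclosed_dense (tclosed_homog hgam (k := k))) => e e0.
have e2 : 0 < e / 2 by rewrite divr_gt0.
have [p wp xp] := wpoly_dense hO x e2; exists (fcoef k p); last first.
  by rewrite -fcoefB; apply: le_trans (nrm_fcoef _ _) _; rewrite mulrC -ler_pdivlMr.
elim: wp => [a b {xp}p /(gword_homog hO hgam) ph|{xp}p q _ hp _ hq]; last first.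
  by rewrite fcoefD; apply: (homogD hgam).
rewrite (fcoef_homog _ ph); case: eqP => [<- //|_]; exact: (homog0 hgam).
Qed.

(** The UHF structure of the core: the degree 0 coefficient of a word polynomial keeps exactly the
    words [S_m S_w^*] with [m] and [w] of equal length. *)
Lemma fixed_dense x (e : R) : homog 0 x -> 0 < e ->
  exists N y, gword S N N y /\ nrm (x - y) <= e.
Proof.
move=> x0 e0; have e2 : 0 < e / 2 by rewrite divr_gt0.
have [p wp xp] := wpoly_dense hO x e2.
suff [N pN] : exists N, gword S N N (fcoef 0 p).
  exists N, (fcoef 0 p); split=> //.
  have -> : x = fcoef 0 x by rewrite (fcoef_homog 0 x0).
  by rewrite -fcoefB; apply: le_trans (nrm_fcoef _ _) _; rewrite mulrC -ler_pdivlMr.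
elim: wp => [a b {xp}p hp|{xp}p q _ [N hp] _ [M hq]].
  rewrite (fcoef_homog _ (gword_homog hO hgam hp)) subr_eq0; case: eqP => [[ab]|_].
    by exists a; rewrite {2}ab.
  by exists 0%N; exact: gword0.
exists (N + M)%N; rewrite fcoefD; apply: gwordD; last exact: gword_widen.
by rewrite addnC; exact: gword_widen.
Qed.

(** A weak uniqueness property of Fourier series, used in [sum_fcoef]. If [p] is homogeneous of
    degree [l], the coefficient of [p * x] is [p * fcoef (- l) x]; density of the word polynomials
    extends this to [y]. *)
Lemma fcoef_eq0 x y : (forall k, fcoef k x = 0) -> fcoef 0 (y * x) = 0.
Proof.
move=> x0; apply: nrm_small => e e0.
have d0 : 0 < 2 * nrm x + 1 by rewrite ltr_wpDl // mulr_ge0 ?nrm_ge0.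
have [p wp yp] := wpoly_dense hO y (divr_gt0 e0 d0).
have -> : fcoef 0 (y * x) = fcoef 0 ((y - p) * x).
  rewrite mulrBl fcoefB; suff -> : fcoef 0 (p * x) = 0 by rewrite subr0.
  elim: wp => [a b {yp}p /(gword_homog hO hgam) ph|{yp}p q _ hp _ hq].
    by rewrite (fcoefMl _ _ ph) x0 mulr0.
  by rewrite mulrDl fcoefD hp hq addr0.
apply: le_trans (nrm_fcoef _ _) _; have := nrmM (y - p) x.
move: yp; rewrite ler_pdivlMr //; have := nrm_ge0 (y - p); lra.
Qed.

End Fourier.

(** * The trace of the core and its scaling *)

Section Trace.
Context {R : realType} {O : cstarAlgType R} (n : nat) (S : 'I_n -> O).
Context (gam : R[i] -> O -> O).
Hypotheses (hn : (2 <= n)%N) (hO : is_cuntz_algebra S) (hgam : is_gauge_action S gam).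
Implicit Types (x y a b : O) (c : R[i]).
Local Notation homog := (homog gam).

Let n_neq0 : n%:R != 0 :> R[i].
Proof. by rewrite pnatr_eq0 -lt0n (ltn_trans _ hn). Qed.

Let n_gt0 : 0 < n%:R :> R.
Proof. by rewrite ltr0n (ltn_trans _ hn). Qed.

Lemma homog0M x y : homog 0 x -> homog 0 y -> homog 0 (x * y).
Proof. by move=> hx hy; have := homogM hgam hx hy; rewrite addr0. Qed.

Lemma homog0_star x : homog 0 x -> homog 0 (star x).
Proof. by move=> hx; have := homog_star hgam hx; rewrite oppr0. Qed.

Lemma homog_starM k x y : homog k x -> homog k y -> homog 0 (star x * y).
Proof.
by move=> hx hy; have := homogM hgam (homog_star hgam hx) hy; rewrite addNr.
Qed.

Lemma homogM_star k x y : homog k x -> homog k y -> homog 0 (x * star y).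
Proof.
by move=> hx hy; have := homogM hgam hx (homog_star hgam hy); rewrite subrr.
Qed.

Lemma homog_slice (k : nat) x i : homog k.+1 x -> homog k (star (S i) * x).
Proof.
move=> hx; have := homogM hgam (homog_star hgam (homogS hgam i)) hx.
by rewrite -[k.+1]addn1 PoszD addrCA addNr addr0.
Qed.

Lemma homog_gwordN N x : gword S N N x -> homog 0 x.
Proof. by move=> /(gword_homog hO hgam); rewrite subrr. Qed.

(** On the matrix algebra [gword N.+1 N.+1] this is the normalized partial trace over the first
    tensor factor, so [N.+1] applications give the normalized trace. *)
Definition transfer x : O := n%:R^-1 *: \sum_(i < n) star (S i) * x * S i.

Lemma transfer_lin c x y : transfer (c *: x + y) = c *: transfer x + transfer y.
Proof.
rewrite /transfer scalerA mulrC -scalerA -scalerDr; congr (_ *: _).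
rewrite scaler_sumr -big_split; apply: eq_bigr => i _.
by rewrite mulrDr mulrDl -scalerAr -scalerAl.
Qed.

Lemma transfer_scalar c : transfer c%:A = c%:A.
Proof.
rewrite /transfer (eq_bigr (fun=> c%:A)) => [|i _]; last first.
  by rewrite -scalerAr -scalerAl mulr1 (isometryS hO).
by rewrite sumr_const card_ord mulrn_scale scalerA mulVf // scale1r.
Qed.

Lemma nrm_transfer x : nrm (transfer x) <= nrm x.
Proof.
rewrite nrmZ nrmcV nrm_nat ler_pdivrMl //; apply: le_trans (ler_nrm_sum _ _ _) _.
have -> : n%:R * nrm x = \sum_(i < n) nrm x by rewrite sumr_const card_ord mulr_natl.
apply: ler_sum => i _; apply: le_trans (nrmM _ _) _; rewrite (nrmS hO) mulr1.
by apply: le_trans (nrmM _ _) _; rewrite nrm_star (nrmS hO) mul1r.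
Qed.

Lemma transfer_star x : transfer (star x) = star (transfer x).
Proof.
rewrite starZ conjc_inv conjc_nat star_sum; congr (_ *: _); apply: eq_bigr => i _.
by rewrite !star_mul starK mulrA.
Qed.

Lemma gword_slice N x i j : gword S N.+1 N.+1 x -> gword S N N (star (S i) * x * S j).
Proof. by move=> /(_ i)/gwordSr/(_ j). Qed.

Lemma gword_transfer N x : gword S N.+1 N.+1 x -> gword S N N (transfer x).
Proof.
by move=> hx; apply/gwordZ/gword_sum => i _; exact: gword_slice.
Qed.

Local Notation tr N := (iter N transfer).

Lemma tr_lin N c x y : tr N (c *: x + y) = c *: tr N x + tr N y.
Proof. by elim: N => //= N ->; rewrite transfer_lin. Qed.

Lemma tr_scalar N c : tr N c%:A = c%:A.
Proof. by elim: N => //= N ->; exact: transfer_scalar. Qed.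

Lemma nrm_tr N x : nrm (tr N x) <= nrm x.
Proof. by elim: N => //= N; exact/le_trans/nrm_transfer. Qed.

Lemma tr_gword N x : gword S N N x ->
  exists c, forall M, (N <= M)%N -> tr M x = c%:A.
Proof.
move=> hx; suff [c E] : exists c, tr N x = c%:A.
  by exists c => M /subnK <-; rewrite iterD E tr_scalar.
elim: N x hx => [//|N IH] x hx; rewrite iterSr.
exact/IH/gword_transfer.
Qed.

Lemma tclosed_scalars : tclosed [set x : O | exists c, x = c%:A].
Proof.
move=> u l us ul.
pose c m := sval (cid (us m)); have cE m : u m = (c m)%:A by rewrite /c; case: cid.
have [e e0|d cd] := @nrm_cauchy_cvg _ c.
  have [M HM] := ul _ (divr_gt0 e0 (ltr0n _ 2)); exists M => m p /HM hm /HM hp.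
  rewrite -(nrmA (O := O)) scalerBl -!cE.
  by have := ler_nrm_dist (u m) l (u p); rewrite (nrmBC l); lra.
exists d; apply: (tends_unique ul) => e /cd[M HM]; exists M => m /HM.
by rewrite cE -scalerBl nrmA.
Qed.

Lemma tr_tends x : homog 0 x -> exists c, tends (fun N => tr N x) c%:A.
Proof.
move=> hx; have trB N y : tr N (x - y) = tr N x - tr N y.
  by rewrite addrC -scaleN1r tr_lin scaleN1r addrC.
have [e e0|l xl] := @nrm_cauchy_tends _ _ (fun N => tr N x).
  have e2 : 0 < e / 2 by rewrite divr_gt0.
  have [N [y [yN xy]]] := fixed_dense hO hgam hx e2.
  have [c cE] := tr_gword yN; exists N => m p /cE mE /cE pE.
  have := nrm_tr m (x - y); have := nrm_tr p (x - y); rewrite !trB mE pE.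
  by have := ler_nrm_dist (tr m x) c%:A (tr p x); rewrite (nrmBC (c%:A : O)); lra.
suff [c lc] : exists c, l = c%:A by exists c; rewrite -lc.
apply: (tclosed_dense tclosed_scalars) => e e0.
have [N [y [yN xy]]] := fixed_dense hO hgam hx e0.
have [c cE] := tr_gword yN; exists c%:A; first by exists c.
apply: le_trans xy.
apply: (@tends_nrm _ _ (fun N => tr N (x - y))) => [|M]; last exact: nrm_tr.
have yc : tends (fun N => tr N y) c%:A by exact: tends_ev cE.
have := tendsD xl (tendsZ (-1) yc); rewrite scaleN1r; apply: tends_ext => M.
by rewrite scaleN1r trB.
Qed.

(* The trace of F_n, as the limit of the averages of S_m^* x S_m over the words
   m of length N; it takes a junk value outside of F_n. *)
Definition tau x : R[i] := xget 0 [set c | tends (fun N => tr N x) c%:A].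

Lemma tauP x : homog 0 x -> tends (fun N => tr N x) (tau x)%:A.
Proof. by move=> /tr_tends; exact: xgetPex. Qed.

Lemma tauE x c : tends (fun N => tr N x) c%:A -> tau x = c.
Proof.
move=> xc; have xt : tends (fun N => tr N x) (tau x)%:A.
  by have /(xgetPex 0) : exists d, [set d | tends (fun N => tr N x) d%:A] d by exists c.
apply/eqP; rewrite -subr_eq0; apply/eqP/nrm_eq0.
by rewrite -(nrmA (O := O)) scalerBl (tends_unique xt xc) subrr nrm0.
Qed.

Lemma tau_lin c x y : homog 0 x -> homog 0 y -> tau (c *: x + y) = c * tau x + tau y.
Proof.
move=> /tauP hx /tauP hy; apply: tauE; rewrite scalerDl -scalerA.
by apply: tends_ext (tendsD (tendsZ c hx) hy) => N; rewrite tr_lin.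
Qed.

Lemma tau_scalar c : tau c%:A = c.
Proof. by apply: tauE; apply: (@tends_ev _ _ _ _ 0%N) => N _; rewrite tr_scalar. Qed.

Lemma tau0 : tau 0 = 0.
Proof. by rewrite -(scale0r 1) tau_scalar. Qed.

Lemma tau1 : tau 1 = 1.
Proof. by rewrite -[X in tau X]scale1r tau_scalar. Qed.

Lemma tauD x y : homog 0 x -> homog 0 y -> tau (x + y) = tau x + tau y.
Proof. by move=> hx hy; rewrite -{1}(scale1r x) tau_lin // mul1r. Qed.

Lemma tauZ c x : homog 0 x -> tau (c *: x) = c * tau x.
Proof.
by move=> hx; rewrite -(addr0 (c *: x)) tau_lin ?tau0 ?addr0 //; exact: (homog0 hgam).
Qed.

Lemma tauB x y : homog 0 x -> homog 0 y -> tau (x - y) = tau x - tau y.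
Proof. by move=> hx hy; rewrite addrC -scaleN1r tau_lin // mulN1r addrC. Qed.

Lemma tau_sum (I : Type) (r : seq I) (P : pred I) (F : I -> O) :
  (forall i, P i -> homog 0 (F i)) ->
  tau (\sum_(i <- r | P i) F i) = \sum_(i <- r | P i) tau (F i).
Proof.
move=> H; suff [] : tau (\sum_(i <- r | P i) F i) = \sum_(i <- r | P i) tau (F i) /\
  homog 0 (\sum_(i <- r | P i) F i) by [].
elim/big_ind2: _ => [|x c y d [<- hx] [<- hy]|i Pi].
- by split; [exact: tau0|exact: (homog0 hgam)].
- by rewrite tauD //; split=> //; exact: (homogD hgam).
- by split=> //; exact: H.
Qed.

Lemma nrm_tau x : homog 0 x -> nrm (tau x) <= nrm x.
Proof.
move=> /tauP hx; rewrite -(nrmA (O := O)).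
by apply: tends_nrm hx _ => N; exact: nrm_tr.
Qed.

Lemma tau_transfer x : homog 0 x -> tau (transfer x) = tau x.
Proof.
move=> /tauP hx; apply: tauE; apply: tends_ext (tends_shift hx) => N.
by rewrite iterSr.
Qed.

Lemma tau_star x : homog 0 x -> tau (star x) = ((tau x)^*)%C.
Proof.
move=> /tauP hx; apply: tauE.
have -> : ((tau x)^*)%C%:A = star (tau x)%:A :> O by rewrite starZ star1.
apply: tends_ext (tends_star hx) => N.
by elim: N => //= N IH; rewrite -IH transfer_star.
Qed.

(** Block matrices: with entries [x_ij = S_i^* x S_j], the value at [x y] is the mean over [i] of
    [\sum_j tau (x_ij y_ji)], which is symmetric in [x] and [y] by induction. *)
Lemma tauC_gword N x y : gword S N N x -> gword S N N y -> tau (x * y) = tau (y * x).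
Proof.
elim: N x y => [|N IH] x y hx hy.
  case: hx hy => c -> [d ->].
  by rewrite -!scalerAl !mul1r !scalerA mulrC.
have tauM u v : gword S N.+1 N.+1 u -> gword S N.+1 N.+1 v -> tau (u * v) =
    n%:R^-1 * \sum_(i < n) \sum_(j < n) tau ((star (S i) * u * S j) * (star (S j) * v * S i)).
  move=> hu hv; have hw i j w : gword S N.+1 N.+1 w -> homog 0 (star (S i) * w * S j).
    by move=> hw; exact/homog_gwordN/gword_slice.
  have hwv i : homog 0 (star (S i) * (u * v) * S i).
    apply/homog_gwordN/gword_slice; exact: gwordM hu hv.
  rewrite -tau_transfer; last exact: homog0M (homog_gwordN hu) (homog_gwordN hv).
  rewrite tauZ; last by apply: (homog_sum hgam).
  congr (_ * _); rewrite tau_sum //; apply: eq_bigr => i _.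
  rewrite -tau_sum; last by move=> j _; apply: homog0M; exact: hw.
  congr tau; rewrite mulrA -mulrA {1}(expandl hO (v * S i)) mulr_sumr.
  by apply: eq_bigr => j _; rewrite !mulrA.
rewrite !tauM //; congr (_ * _); rewrite exchange_big; apply: eq_bigr => i _.
by apply: eq_bigr => j _; apply: IH; exact: gword_slice.
Qed.

Lemma tauC x y : homog 0 x -> homog 0 y -> tau (x * y) = tau (y * x).
Proof.
move=> hx hy.
(* [red] reduces the left factor to words by continuity. It is used for [x], then for [y] after
   exchanging the two sides. *)
have red u v : homog 0 u -> homog 0 v ->
    (forall N u', gword S N N u' -> tau (u' * v) = tau (v * u')) ->
    tau (u * v) = tau (v * u).
  move=> hu hv H; apply/eqP; rewrite -subr_eq0; apply/eqP/nrm_small => e e0.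
  have d0 : 0 < 2 * nrm v + 1 by rewrite ltr_wpDl // mulr_ge0 ?nrm_ge0.
  have [N [u' [gu uu']]] := fixed_dense hO hgam hu (divr_gt0 e0 d0).
  have hu' := homog_gwordN gu.
  have huu' : homog 0 (u - u') by apply: (homogB hgam).
  have -> : tau (u * v) - tau (v * u) = tau ((u - u') * v) - tau (v * (u - u')).
    rewrite mulrBl mulrBr !tauB; try exact: homog0M.
    by rewrite (H _ _ gu) opprB addrA subrK.
  have := ler_nrmB (tau ((u - u') * v)) (tau (v * (u - u'))).
  have := nrm_tau (homog0M huu' hv); have := nrm_tau (homog0M hv huu').
  have := nrmM (u - u') v; have := nrmM v (u - u').
  move: uu'; rewrite ler_pdivlMr //; have := nrm_ge0 (u - u'); nra.
apply: (red) => // N x' gx; symmetry; apply: (red) => //; first exact: homog_gwordN gx.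
move=> M y' gy; apply: (@tauC_gword (N + M)); first exact: (gword_widen hO).
by rewrite addnC; exact: (gword_widen hO).
Qed.

End Trace.

(** * Positivity of the trace and the KMS relation *)

Section Positivity.
Context {R : realType} {O : cstarAlgType R} (n : nat) (S : 'I_n -> O).
Context (gam : R[i] -> O -> O).
Hypotheses (hn : (2 <= n)%N) (hO : is_cuntz_algebra S) (hgam : is_gauge_action S gam).
Implicit Types (x y a b : O) (c : R[i]).
Local Notation homog := (homog gam).
Local Notation tau := (tau S).

Let n_gt0 : 0 < n%:R :> R.
Proof. by rewrite ltr0n (ltn_trans _ hn). Qed.

(** The squared 2-norm of the trace. Taking the real part loses nothing on homogeneous elements, by
    [tau_sq]. *)
Definition sq x : R := complex.Re (tau (star x * x)).

Lemma tau_sq k x : homog k x -> tau (star x * x) = (sq x)%:C%C.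
Proof.
move=> hx; have := tau_star hn hO hgam (homog_starM hgam hx hx).
rewrite star_mul starK /sq; case: (tau _) => r i [] /eqP.
by rewrite -addr_eq0 -mulr2n mulrn_eq0 /= => /eqP ->.
Qed.

Lemma ler_sq k x : homog k x -> sq x <= nrm x ^+ 2.
Proof.
move=> hx; have h0 := homog_starM hgam hx hx.
apply: le_trans (ler_norm _) _; apply: le_trans (ler_Re_nrm _) _.
by apply: le_trans (nrm_tau hn hO hgam h0) _; rewrite nrm_starM.
Qed.

Lemma sq_slicel (k : nat) x : homog k.+1 x -> sq x = \sum_(i < n) sq (star (S i) * x).
Proof.
move=> hx; have hi i := homog_slice hgam i hx.
apply: (@complexI R); rewrite -(tau_sq hx) rmorph_sum /=.
under eq_bigr do rewrite -(tau_sq (hi _)).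
rewrite -(tau_sum hn hO hgam); last by move=> i _; exact: (homog_starM hgam (hi i) (hi i)).
congr tau; rewrite {2}(expandl hO x) mulr_sumr; apply: eq_bigr => i _.
by rewrite star_mul starK mulrA.
Qed.

Lemma sq_corner x : homog 0 x ->
  sq x = n%:R^-1 * \sum_(i < n) \sum_(j < n) sq (star (S i) * x * S j).
Proof.
move=> hx; have hij i j : homog 0 (star (S i) * x * S j).
  rewrite -mulrA; apply: (homog_starM hgam (homogS hgam i)).
  by have := homogM hgam hx (homogS hgam j); rewrite add0r.
have hj j : homog 1 (x * S j) by have := homogM hgam hx (homogS hgam j); rewrite add0r.
have hjj j := homog_starM hgam (hj j) (hj j).
apply: (@complexI R); rewrite -(tau_sq hx) rmorphM fmorphV rmorph_nat.
rewrite -(tau_transfer hn hO hgam (homog_starM hgam hx hx)) /transfer.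
have E j : star (S j) * (star x * x) * S j = star (x * S j) * (x * S j).
  by rewrite star_mul !mulrA.
under eq_bigr do rewrite E.
rewrite (tauZ hn hO hgam); last by apply: (homog_sum hgam).
congr (_ * _).
rewrite (tau_sum hn hO hgam) // exchange_big rmorph_sum; apply: eq_bigr => j _.
rewrite (tau_sq (hj j)) (@sq_slicel 0 _ (hj j)); congr (_%:C)%C.
by apply: eq_bigr => i _; rewrite mulrA.
Qed.

(** Positivity is read off matrix entries: [sq_corner] writes [sq y] as a multiple of the sum over
    the [n ^ 2] blocks of [y], down to [|c|^2] for a scalar. For the norm bound, each block has norm
    at most [sqrt (D n sq y)] and [y] is the sum of the [n ^ 2] blocks; the resulting [D] grows with
    [N]. *)
Lemma sq_gword N : exists2 D : R, 0 <= D &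
  forall y, gword S N N y -> 0 <= sq y /\ nrm y ^+ 2 <= D * sq y.
Proof.
elim: N => [|N [D D0 IH]].
  exists 1 => // y [c yc]; rewrite mul1r; have hy : homog 0 y.
    by rewrite yc; exact: (homogZ hgam c (homog1 hgam)).
  suff -> : sq y = nrm y ^+ 2 by rewrite sqr_ge0.
  apply: (@complexI R); rewrite -(tau_sq hy) yc starZ star1 -scalerAl mul1r scalerA.
  by rewrite (tau_scalar hn hO) mulrC mulcJ nrmA.
exists ((n%:R ^+ 2) ^+ 2 * (D * n%:R)); first by rewrite !mulr_ge0 // ltW.
move=> y gy; have hy := homog_gwordN hO hgam gy.
have gij i j : gword S N N (star (S i) * y * S j) by exact: gword_slice.
have s0 i j : 0 <= sq (star (S i) * y * S j) by case: (IH _ (gij i j)).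
have sy := sq_corner hy.
split; first by rewrite sy mulr_ge0 ?invr_ge0 ?sumr_ge0 // => i _; rewrite sumr_ge0.
pose B := Num.sqrt (D * (n%:R * sq y)).
have D1 i j : nrm (star (S i) * y * S j) <= B.
  rewrite -[leLHS]ger0_norm ?nrm_ge0 // -sqrtr_sqr ler_wsqrtr //.
  have [_ H] := IH _ (gij i j); apply: le_trans H _; rewrite ler_wpM2l // sy.
  rewrite mulVKf ?gt_eqF // (bigD1 i) //= (bigD1 j) //= -addrA lerDl.
  by rewrite addr_ge0 ?sumr_ge0 // => i' _; rewrite sumr_ge0.
have yE : y = \sum_(i < n) \sum_(j < n) S i * (star (S i) * y * S j) * star (S j).
  rewrite {1}(expandl hO y); apply: eq_bigr => i _.
  rewrite {1}(expandr hO (star (S i) * y)) mulr_sumr; apply: eq_bigr => j _.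
  by rewrite !mulrA.
have yB : nrm y <= n%:R ^+ 2 * B.
  rewrite yE; apply: le_trans (ler_nrm_sum _ _ _) _.
  have -> : n%:R ^+ 2 * B = \sum_(i < n) \sum_(j < n) B.
    by rewrite !sumr_const !card_ord -mulrnA -[RHS]mulr_natl natrM expr2.
  apply: ler_sum => i _; apply: le_trans (ler_nrm_sum _ _ _) _.
  apply: ler_sum => j _; apply: le_trans (nrmM _ _) _.
  rewrite nrm_star (nrmS hO) mulr1; apply: le_trans (nrmM _ _) _.
  by rewrite (nrmS hO) mul1r.
have B2 : B ^+ 2 = D * (n%:R * sq y).
  rewrite sqr_sqrtr // mulr_ge0 // mulr_ge0 //.
  by rewrite sy mulr_ge0 ?invr_ge0 ?sumr_ge0 // => i _; rewrite sumr_ge0.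
rewrite -mulrA -(mulrA D) -B2 -exprMn.
by rewrite ler_pXn2r ?nnegrE ?nrm_ge0 // (le_trans (nrm_ge0 y)).
Qed.

Lemma sq_ge0_fixed x : homog 0 x -> 0 <= sq x.
Proof.
move=> hx; apply/ler_addgt0Pr => e e0.
(* The bound 1 gives [|p| <= |x| + 1], so replacing [x] by [p] changes [sq] by at most
   [d (2 |x| + 1) <= e]. *)
pose d := Num.min 1 (e / (2 * nrm x + 1)).
have d1 : 0 < 2 * nrm x + 1 by rewrite ltr_wpDl // mulr_ge0 ?nrm_ge0.
have d0 : 0 < d by rewrite lt_min ltr01 divr_gt0.
have [N [p [gp xp]]] := fixed_dense hO hgam hx d0.
have [D _ /(_ _ gp)[p0 _]] := sq_gword N; have hp := homog_gwordN hO hgam gp.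
have hr : homog 0 (x - p) by apply: (homogB hgam).
have hw : homog 0 (star x * (x - p) + star (x - p) * p).
  exact: (homogD hgam (homog_starM hgam hx hr) (homog_starM hgam hr hp)).
have -> : sq x = sq p + complex.Re (tau (star x * (x - p) + star (x - p) * p)).
  rewrite /sq -raddfD /= -(tauD hn hO hgam); first last.
  - exact: hw.
  - exact: (homog_starM hgam hp hp).
  by congr (complex.Re (tau _)); rewrite starB mulrBr mulrBl; abel.
have := nrm_tau hn hO hgam hw; have := ler_Re_nrm (tau (star x * (x - p) + star (x - p) * p)).
move: (tau _) => t; have := ler_nrmD (star x * (x - p)) (star (x - p) * p).
have := nrmM (star x) (x - p); have := nrmM (star (x - p)) p; rewrite !nrm_star.
have := ler_nrm_dist p x 0; rewrite !subr0 (nrmBC p).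
have := nrm_ge0 x; have := nrm_ge0 (x - p); have := nrm_ge0 p.
have := ler_norm (- complex.Re t); rewrite normrN.
have [k1 k2] : nrm (x - p) <= 1 /\ nrm (x - p) * (2 * nrm x + 1) <= e.
  by move: xp; rewrite le_min -ler_pdivlMr // => /andP[].
nra.
Qed.

(** Each degree costs one factor [n^-1]: removing a generator from the left of both [x] and [y]
    turns [tau (star y * x)] into a sum over [i], but [tau (x * star y)], through [transfer], into a
    mean over [i]. *)
Lemma kms (k : nat) x y : homog k x -> homog k y ->
  tau (x * star y) = n%:R^-1 ^+ k * tau (star y * x).
Proof.
elim: k x y => [|k IH] x y hx hy.
  by rewrite expr0 mul1r (tauC hn hO hgam) //; exact: (homog0_star hgam).
have hxi i := homog_slice hgam i hx; have hyi i := homog_slice hgam i hy.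
rewrite -(tau_transfer hn hO hgam (homogM_star hgam hx hy)) /transfer.
have E i : star (S i) * (x * star y) * S i = (star (S i) * x) * star (star (S i) * y).
  by rewrite star_mul starK !mulrA.
under eq_bigr do rewrite E.
have h i := homogM_star hgam (hxi i) (hyi i).
rewrite (tauZ hn hO hgam); last by apply: (homog_sum hgam).
rewrite (tau_sum hn hO hgam) //.
under eq_bigr do rewrite (IH _ _ (hxi _) (hyi _)).
rewrite -mulr_sumr exprS -mulrA -(tau_sum hn hO hgam); last first.
  by move=> i _; exact: (homog_starM hgam (hyi i) (hxi i)).
congr (_ * (_ * tau _)); rewrite [in RHS](expandl hO x) mulr_sumr.
by apply: eq_bigr => i _; rewrite star_mul starK !mulrA.
Qed.

Lemma sq_ge0 k x : homog k x -> 0 <= sq x.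
Proof.
have pos (m : nat) y : homog m y -> 0 <= sq y.
  elim: m y => [|m IH] y hy; first exact: sq_ge0_fixed.
  by rewrite (sq_slicel hy) sumr_ge0 // => i _; apply/IH/homog_slice.
case: k => m hx; first exact: pos hx.
have hs : homog m.+1 (star x) by have := homog_star hgam hx; rewrite NegzE opprK.
have := kms hs hs; rewrite starK (tau_sq hx).
have := tau_sq hs; rewrite starK => ->.
rewrite -(rmorph_nat (real_complex R)) -fmorphV -rmorphXn -rmorphM /= => /complexI ->.
by rewrite mulr_ge0 ?(pos _ _ hs) // exprn_ge0 // invr_ge0 ltW.
Qed.

Lemma tau_starC k x y : homog k x -> homog k y ->
  tau (star y * x) = ((tau (star x * y))^*)%C.
Proof.
move=> hx hy; rewrite -(tau_star hn hO hgam (homog_starM hgam hx hy)).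
by rewrite star_mul starK.
Qed.

Lemma cauchy_schwarz k x y : homog k x -> homog k y ->
  nrm (tau (star x * y)) ^+ 2 <= sq x * sq y.
Proof.
move=> hx hy; pose t := tau (star x * y); pose a := nrm t ^+ 2.
have H (s : R) : 0 <= sq x - 2 * s * a + s ^+ 2 * a * sq y.
  pose c := s%:C%C * (t^*)%C; have hz : homog k (x - c *: y).
    by apply: (homogB hgam) => //; exact: (homogZ hgam).
  suff <- : sq (x - c *: y) = sq x - 2 * s * a + s ^+ 2 * a * sq y by exact: sq_ge0 hz.
  apply: (@complexI R); rewrite -(tau_sq hz).
  have -> : star (x - c *: y) * (x - c *: y) = star x * x - c *: (star x * y) -
      ((c^*)%C *: (star y * x) - ((c^*)%C * c) *: (star y * y)).
    by rewrite starB starZ mulrBl !mulrBr -!scalerAl -!scalerAr scalerA.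
  have hxx := homog_starM hgam hx hx; have hxy := homog_starM hgam hx hy.
  have hyx := homog_starM hgam hy hx; have hyy := homog_starM hgam hy hy.
  rewrite !(tauB hn hO hgam) ?(tauZ hn hO hgam) //;
    try by do ?apply: (homogB hgam); do ?apply: (homogZ hgam).
  have -> : (c^*)%C = s%:C%C * t 
    by rewrite /c conjcM conjcK conjc_real.
  rewrite (tau_sq hx) (tau_sq hy) (tau_starC hx hy) -/t /c.
  have tt : t * (t^*)%C = a%:C%C by rewrite mulcJ.
  clearbody a t; have -> u v w : u - v * (t^*)%C * t -
      (v * t * (t^*)%C - v * t * (v * (t^*)%C) * w) =
      u - 2 * v * (t * (t^*)%C) + v ^+ 2 * (t * (t^*)%C) * w by ring.
  by rewrite tt; ring.
have a0 : 0 <= a by rewrite sqr_ge0.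
have [y0|y0] := ltrP 0 (sq y).
  have := H (sq y)^-1; rewrite -/t -/a.
  have -> : sq x - 2 * (sq y)^-1 * a + (sq y)^-1 ^+ 2 * a * sq y = sq x - a / sq y.
    by field; rewrite gt_eqF.
  by rewrite subr_ge0 ler_pdivrMr.
have sy0 : sq y = 0 by apply/eqP; rewrite eq_le y0 (sq_ge0 hy).
rewrite -/t -/a sy0 mulr0 leNgt; apply/negP => ap.
(* When [sq y = 0] the quadratic is affine in [s], and this [s] gives it the value -1. *)
have := H ((sq x + 1) / (2 * a)); rewrite sy0 mulr0 addr0.
have -> : 2 * ((sq x + 1) / (2 * a)) * a = sq x + 1 by field; rewrite gt_eqF.
lra.
Qed.

End Positivity.

(** * Faithfulness of the trace *)

Section Faithful.
Context {R : realType} {O : cstarAlgType R} (n : nat) (S : 'I_n -> O).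
Context (gam : R[i] -> O -> O).
Hypotheses (hn : (2 <= n)%N) (hO : is_cuntz_algebra S) (hgam : is_gauge_action S gam).
Implicit Types (x y a b : O) (c : R[i]).
Local Notation homog := (homog gam).
Local Notation tau := (tau S).
Local Notation sq := (sq S).

Let n_gt0 : 0 < n%:R :> R.
Proof. by rewrite ltr0n (ltn_trans _ hn). Qed.

Lemma tau_mul_null k x y : homog k x -> homog k y -> sq y = 0 -> tau (star x * y) = 0.
Proof.
move=> hx hy y0; apply: nrm_eq0; apply/eqP; rewrite -sqrf_eq0 eq_le sqr_ge0 andbT.
by apply: le_trans (cauchy_schwarz hn hO hgam hx hy) _; rewrite y0 mulr0.
Qed.

Lemma homog0X x k : homog 0 x -> homog 0 (x ^+ k).
Proof.
move=> hx; elim: k => [|k IH]; first exact: (homog1 hgam).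
by rewrite exprS; exact: (homog0M hgam).
Qed.

Lemma gwordX N x k : gword S N N x -> gword S N N (x ^+ k).
Proof.
move=> hx; elim: k => [|k IH]; last by rewrite exprS; exact: gwordM hx IH.
have := @gword_widen _ _ _ _ hO N 0 0 1; rewrite !addn0; apply.
by exists 1; rewrite scale1r.
Qed.

(* The elements a with tau (F_n a) = 0 form an ideal.  An x in some matrix
   algebra close to a satisfies tau (x^k) = tau ((x - a)^k), while the trace
   dominates a fixed multiple of the norm on that matrix algebra: taking large
   powers, |x| <= |x - a|. *)
Lemma faithful_fixed b : homog 0 b -> sq b = 0 -> b = 0.
Proof.
move=> hb b0; have hbs := homog0_star hgam hb.
pose a := star b * b; have ha : homog 0 a by exact: (homog_starM hgam hb hb).
have a_s : star a = a by rewrite /a star_mul starK.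
have ta y : homog 0 y -> tau (y * a) = 0.
  move=> hy; rewrite /a mulrA -[y * star b]starK.
  by apply: (tau_mul_null _ hb b0); apply: (homog0_star hgam); exact: (homog0M hgam).
suff : a = 0.
  move=> a0; apply: nrm_eq0; apply/eqP; rewrite -sqrf_eq0 -nrm_starM -/a a0.
  by rewrite nrm0.
(* With [e = |a| / 3] the approximation satisfies [|x - a| <= e] and [|x| >= 2 e]. Comparing powers
   then gives [2 ^ (2 ^ M * 2) <= D], which fails for [M] above [D]. *)
apply: contrapT => /eqP/nrm_gt0 na; pose e := nrm a / 3.
have e0 : 0 < e by rewrite divr_gt0.
have [N [p [gp ap]]] := fixed_dense hO hgam ha e0.
pose x := 2^-1 *: (p + star p).
have x_s : star x = x.
  by rewrite /x starZ conjc_inv conjc_nat starD starK addrC.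
have gx : gword S N N x by apply/gwordZ/gwordD => //; exact: gword_star.
have hx := homog_gwordN hO hgam gx.
pose r := x - a; have hr : homog 0 r by exact: (homogB hgam hx ha).
have re : nrm r <= e.
  have -> : r = - (2^-1 *: ((a - p) + star (a - p))).
    rewrite /r -{1}(scaler_half a) starB a_s /x -scalerBr -scalerN; congr (_ *: _).
    abel.
  rewrite nrmN nrmZ nrmcV nrm_nat; have := ler_nrmD (a - p) (star (a - p)).
  by rewrite nrm_star; lra.
have xe : 2 * e <= nrm x.
  have := ler_nrm_dist a x 0; rewrite !subr0 (nrmBC a) -/r.
  have : nrm a = 3 * e by rewrite /e mulrC divfK // pnatr_eq0.
  lra.
(* Write one factor [x] as [r + a]; the term with [a] vanishes because the trace moves [a] to the
   right end, where [ta] applies. *)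
have trx k j : tau (x ^+ k * r ^+ j) = tau (r ^+ (k + j)).
  elim: k j => [|k IH] j; first by rewrite mul1r.
  have hk := homog0X k hx; have hj := homog0X j hr.
  have -> : x ^+ k.+1 * r ^+ j = x ^+ k * r ^+ j.+1 + x ^+ k * a * r ^+ j.
    by rewrite exprSr exprS mulrA -mulrDl -mulrDr /r subrK.
  have hka := homog0M hgam hk ha.
  rewrite (tauD hn hO hgam) ?(tauC hn hO hgam hka hj); first last.
  - exact: (homog0M hgam hka hj).
  - exact: (homog0M hgam hk (homog0X j.+1 hr)).
  - by rewrite IH addnS mulrA ta ?addr0 //; exact: (homog0M hgam).
have [D D0 HD] := sq_gword hn hO hgam N.
pose M := (Num.truncn D).+1.
have [_] := HD _ (gwordX (2 ^ M) gx).
rewrite nrmX2k // => HM.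
have H2 : sq (x ^+ (2 ^ M)) <= e ^+ (2 ^ M * 2).
  rewrite /sq starX x_s -exprD addnn -muln2.
  have := trx (2 ^ M * 2)%N 0%N; rewrite expr0 mulr1 addn0 => ->.
  apply: le_trans (ler_norm _) _; apply: le_trans (ler_Re_nrm _) _.
  apply: le_trans (nrm_tau hn hO hgam (homog0X _ hr)) _.
  by apply: le_trans (nrmX _ _) _; rewrite lerXn2r ?nnegrE ?nrm_ge0 // ltW.
have H3 : (2 * e) ^+ (2 ^ M * 2) <= D * e ^+ (2 ^ M * 2).
  apply: le_trans (_ : nrm x ^+ (2 ^ M * 2) <= _).
    by rewrite lerXn2r ?nnegrE ?nrm_ge0 // mulr_ge0 // ltW.
  by rewrite exprM; apply: le_trans HM _; rewrite ler_wpM2l.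
move: H3; rewrite exprMn ler_pM2r ?exprn_gt0 // leNgt => /negP; apply.
apply: lt_le_trans (truncnS_gt D) _; rewrite -natrX ler_nat -/M.
have MM : (M <= 2 ^ M)%N by rewrite ltnW // ltn_expl.
by apply: (leq_trans MM); rewrite leq_exp2l // (leq_trans MM) // leq_pmulr.
Qed.

Lemma sq_star (m : nat) x : homog m x -> sq (star x) = n%:R^-1 ^+ m * sq x.
Proof.
move=> hx; have := kms hn hO hgam hx hx; rewrite (tau_sq hn hO hgam hx).
have := tau_sq hn hO hgam (homog_star hgam hx); rewrite starK => ->.
by rewrite -(rmorph_nat (real_complex R)) -fmorphV -rmorphXn -rmorphM /= => /complexI.
Qed.

Lemma faithful k x : homog k x -> sq x = 0 -> x = 0.
Proof.
have pos (m : nat) y : homog m y -> sq y = 0 -> y = 0.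
  elim: m y => [|m IH] y hy; first exact: faithful_fixed.
  have hi i := homog_slice hgam i hy.
  rewrite (sq_slicel hn hO hgam hy) => /eqP; rewrite psumr_eq0 => [/allP s0|i _].
    rewrite (expandl hO y) big1 // => i _; rewrite (IH _ (hi i)) ?mulr0 //.
    by apply/eqP/s0; rewrite mem_index_enum.
  exact: (sq_ge0 hn hO hgam (hi i)).
case: k => m hx x0; first exact: pos hx x0.
have hs : homog m.+1 (star x) by have := homog_star hgam hx; rewrite NegzE opprK.
have q0 : n%:R^-1 ^+ m.+1 != 0 :> R by rewrite expf_neq0 // invr_neq0 // gt_eqF.
have := sq_star hs; rewrite starK x0 => /esym/eqP.
rewrite mulf_eq0 (negPf q0) => /eqP s0.
by rewrite -(starK x) (pos _ _ hs s0) star0.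
Qed.

Lemma kms_int (k : int) : exists2 q : R, 0 < q & forall x y, homog k x -> homog k y ->
  tau (x * star y) = q%:C%C * tau (star y * x).
Proof.
have nC : n%:R != 0 :> R[i] by rewrite pnatr_eq0 -lt0n (ltn_trans _ hn).
case: k => m; first exists (n%:R^-1 ^+ m).
- by rewrite exprn_gt0 // invr_gt0.
- by move=> x y hx hy; rewrite (kms hn hO hgam hx hy) rmorphXn fmorphV rmorph_nat.
exists (n%:R ^+ m.+1); first by rewrite exprn_gt0.
move=> x y hx hy.
have hxs : homog m.+1 (star x) by have := homog_star hgam hx; rewrite NegzE opprK.
have hys : homog m.+1 (star y) by have := homog_star hgam hy; rewrite NegzE opprK.
have := kms hn hO hgam hys hxs; rewrite !starK => ->.
by rewrite rmorphXn rmorph_nat mulrA -exprMn mulfV // expr1n mul1r.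
Qed.

(* 1 - h / (8 |h|) is the square of a self-adjoint element of F_n. *)
Lemma tau_order k x h : homog k x -> homog 0 h -> star h = h ->
  complex.Re (tau (star x * x * h)) <= 8 * nrm h * sq x.
Proof.
move=> hx hh hs; have [h0|h0] := eqVneq h 0.
  by rewrite h0 mulr0 (tau0 hn hO) nrm0 mulr0 mul0r.
have nh := nrm_gt0 h0.
pose c : R := (8 * nrm h)^-1; have c0 : 0 < c by rewrite invr_gt0 mulr_gt0.
pose d := c%:C%C *: h; have hd : homog 0 d by exact: (homogZ hgam).
have ds : star d = d by rewrite starZ conjc_real hs.
have d8 : nrm d <= 8^-1.
  by rewrite nrmZ nrm_real gtr0_norm // /c invfM -mulrA mulVf ?mulr1 // gt_eqF.
pose Z : set O := [set y | homog 0 y /\ star y = y] `&`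
  [set y | forall a, [set d] a -> y * a = a * y].
have [||y Zy|y [[hy ys] yd] yE] := @isqrt_exists _ _ d Z d8.
- move=> u l uZ ul; split; last by apply: tclosed_commutant ul => m; case: (uZ m).
  split; last by apply: tclosed_self ul => m; case: (uZ m) => -[].
  by apply: (tclosed_homog hgam) ul => m; case: (uZ m) => -[].
- split; last by move=> a ->; rewrite mul0r mulr0.
  by split; [exact: (homog0 hgam)|exact: star0].
- case: Zy => -[hy ys] /(_ _ erefl) yd; split; last by move=> _ ->; exact: comm_isqrt_step.
  split; last exact: star_isqrt_step.
  apply: (homogZ hgam); apply: (homogB hgam); last exact: (homog0M hgam).
  apply: (homogD hgam); last exact: (homog0M hgam (homog0M hgam hy hy) hd).
  by apply: (homogD hgam) => //; apply: (homog0M hgam) => //; apply: (homogD hgam).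
have {}yd := yd _ erefl.
have te := comm_1B (comm_1D yd).
pose s := (1 + y) * (1 - d).
have ss : star s = s by rewrite /s star_mul starB starD star1 ds ys te.
have hs1 : homog 0 s.
  apply: (homog0M hgam); first by apply: (homogD hgam) => //; exact: (homog1 hgam).
  by apply: (homogB hgam) => //; exact: (homog1 hgam).
have s2 : s * s = 1 - d by rewrite /s mulrA -(mulrA (1 + y)) -te mulrA yE mul1r.
have hxs : homog k (x * s) by have := homogM hgam hx hs1; rewrite addr0.
have hxx := homog_starM hgam hx hx.
have := sq_ge0 hn hO hgam hxs; rewrite /sq star_mul ss -mulrA (mulrA (star x)).
rewrite -(tauC hn hO hgam (homog0M hgam hxx hs1) hs1) -mulrA s2 mulrBr mulr1.
rewrite /d -scalerAr (tauB hn hO hgam) //; last first.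
  by apply: (homogZ hgam); exact: (homog0M hgam).
rewrite (tauZ hn hO hgam); last exact: (homog0M hgam).
rewrite raddfB /= subr_ge0; case: (tau (star x * x * h)) => u v /=.
rewrite mul0r subr0 /c mulrC ler_pdivrMr ?mulr_gt0 // mulrC; exact.
Qed.

End Faithful.

(** * Finite-dimensionality of the graded relative commutant *)

Section OrthonormalBases.
Context {R : realType} {O : cstarAlgType R} (n : nat) (S : 'I_n -> O).
Context (gam : R[i] -> O -> O).
Hypotheses (hn : (2 <= n)%N) (hO : is_cuntz_algebra S) (hgam : is_gauge_action S gam).
Implicit Types (x y a b : O) (c : R[i]).
Local Notation homog := (homog gam).
Local Notation tau := (tau S).
Local Notation sq := (sq S).

Definition orthonormal N (e : 'I_N -> O) : Prop :=
  forall i j, tau (star (e i) * e j) = (i == j)%:R.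

Definition orthonormal_basis N (e : 'I_N -> O) (V : set O) : Prop :=
  [/\ forall i, V (e i), orthonormal e &
      forall x, V x -> x = \sum_(i < N) tau (star (e i) * x) *: e i].

Section Family.
Variables (k : int) (N : nat) (e : 'I_N -> O).
Hypotheses (eh : forall i, homog k (e i)) (eo : orthonormal e).

Lemma homog_comb (c : 'I_N -> R[i]) : homog k (\sum_(i < N) c i *: e i).
Proof. by apply: (homog_sum hgam) => i _; exact: (homogZ hgam). Qed.

Lemma tau_comb (c : 'I_N -> R[i]) y : homog k y ->
  tau (star y * \sum_(i < N) c i *: e i) = \sum_(i < N) c i * tau (star y * e i).
Proof.
move=> hy; rewrite mulr_sumr (tau_sum hn hO hgam) => [|i _].
  apply: eq_bigr => i _; rewrite -scalerAr (tauZ hn hO hgam) //.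
  exact: (homog_starM hgam hy (eh i)).
exact: (homog_starM hgam hy (homogZ hgam _ (eh i))).
Qed.

Lemma coef_comb (c : 'I_N -> R[i]) j : tau (star (e j) * \sum_(i < N) c i *: e i) = c j.
Proof.
rewrite tau_comb // (bigD1 j) //= eo eqxx mulr1 big1 ?addr0 // => i ij.
by rewrite eo eq_sym (negPf ij) mulr0.
Qed.

Lemma sq_comb (c : 'I_N -> R[i]) :
  sq (\sum_(i < N) c i *: e i) = \sum_(i < N) nrm (c i) ^+ 2.
Proof.
apply: (@complexI R); rewrite -(tau_sq hn hO hgam (homog_comb c)) rmorph_sum /=.
rewrite (tau_comb c (homog_comb c)); apply: eq_bigr => i _.
rewrite (tau_starC hn hO hgam (eh i) (homog_comb c)) coef_comb mulcJ.
by [].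
Qed.

Lemma bessel y : homog k y -> \sum_(i < N) nrm (tau (star (e i) * y)) ^+ 2 <= sq y.
Proof.
move=> hy; pose c i := tau (star (e i) * y); pose p := \sum_(i < N) c i *: e i.
have hp : homog k p by exact: homog_comb.
have hyp : homog k (y - p) by exact: (homogB hgam hy hp).
have := sq_ge0 hn hO hgam hyp; suff -> : sq (y - p) = sq y - sq p.
  by rewrite sq_comb subr_ge0.
apply: (@complexI R); rewrite -(tau_sq hn hO hgam hyp) rmorphB /=.
rewrite -(tau_sq hn hO hgam hy) -(tau_sq hn hO hgam hp).
have hpp := homog_starM hgam hp hp; have hyp' := homog_starM hgam hy hp.
have hpy := homog_starM hgam hp hy; have hyy := homog_starM hgam hy hy.
have pp : tau (star p * p) = tau (star y * p).
  rewrite {2}/p (tau_comb c hp) (tau_comb c hy); apply: eq_bigr => i _; congr (_ * _).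
  rewrite (tau_starC hn hO hgam (eh i) hp) (tau_starC hn hO hgam (eh i) hy).
  by rewrite coef_comb.
have -> : star (y - p) * (y - p) = star y * y - star y * p - (star p * y - star p * p).
  by rewrite starB mulrBl !mulrBr.
have h1 : homog 0 (star y * y - star y * p) by exact: (homogB hgam).
have h2 : homog 0 (star p * y - star p * p) by exact: (homogB hgam).
rewrite !(tauB hn hO hgam) // pp (tau_starC hn hO hgam hy hp) -pp.
by rewrite (tau_sq hn hO hgam hp) conjc_real subrr subr0.
Qed.

End Family.

Lemma orthonormal_extend (k : int) (V : set O) N (e : 'I_N -> O) x :
  (forall y, V y -> homog k y) -> (forall c y z, V y -> V z -> V (c *: y + z)) ->
  (forall i, V (e i)) -> orthonormal e -> V x ->
  x <> \sum_(i < N) tau (star (e i) * x) *: e i ->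
  exists e' : 'I_N.+1 -> O, (forall i, V (e' i)) /\ orthonormal e'.
Proof.
move=> Vh Vl Ve eo Vx xe; have eh i := Vh _ (Ve i).
pose c i := tau (star (e i) * x); pose p := \sum_(i < N) c i *: e i.
have hp : homog k p by exact: homog_comb.
have Vr : V (x - p).
  have : forall r : seq 'I_N, V (x - \sum_(i <- r) c i *: e i).
    elim=> [|i r IH]; first by rewrite big_nil subr0.
    rewrite big_cons opprD addrCA -scaleNr; exact: Vl.
  by apply.
have hr := Vh _ Vr.
have r0 : 0 < sq (x - p).
  rewrite lt_def (sq_ge0 hn hO hgam hr) andbT; apply/eqP.
  by move=> /(faithful hn hO hgam hr)/eqP; rewrite subr_eq0 => /eqP.
pose d : R := (Num.sqrt (sq (x - p)))^-1.
have d0 : 0 < d by rewrite invr_gt0 sqrtr_gt0.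
pose v := d%:C%C *: (x - p).
have Vv : V v.
  have -> : v = (d%:C%C - 1) *: (x - p) + (x - p) by rewrite scalerBl scale1r subrK.
  exact: Vl.
have ev i : tau (star (e i) * v) = 0.
  have hex := homog_starM hgam (eh i) (Vh _ Vx); have hep := homog_starM hgam (eh i) hp.
  rewrite -scalerAr mulrBr (tauZ hn hO hgam); last exact: (homogB hgam).
  by rewrite (tauB hn hO hgam) // (coef_comb eh eo) subrr mulr0.
have vv : tau (star v * v) = 1.
  rewrite /v starZ conjc_real -scalerAl -scalerAr scalerA (tauZ hn hO hgam); last first.
    exact: (homog_starM hgam hr hr).
  rewrite (tau_sq hn hO hgam hr) -!rmorphM /=.
  suff -> : d * d * sq (x - p) = 1 by rewrite rmorph1.
  rewrite -[X in _ * X](sqr_sqrtr (ltW r0)) /d; field.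
  by rewrite gt_eqF // sqrtr_gt0.
pose e' (i : 'I_N.+1) := if unlift ord0 i is Some j then e j else v.
exists e'; split=> [i|i j]; rewrite /e'; first by case: unliftP.
case: (unliftP ord0 i) => [i' ->|->]; case: (unliftP ord0 j) => [j' ->|->].
- by rewrite eo (inj_eq lift_inj).
- by rewrite ev eq_sym (negPf (neq_lift _ _)).
- by rewrite (tau_starC hn hO hgam (eh j') (Vh _ Vv)) ev conjc0 (negPf (neq_lift _ _)).
- by rewrite vv eqxx.
Qed.

Lemma orthonormal_basis_exists (k : int) (V : set O) (M : nat) :
  (forall y, V y -> homog k y) -> (forall c y z, V y -> V z -> V (c *: y + z)) ->
  (forall N (e : 'I_N -> O), (forall i, V (e i)) -> orthonormal e -> (N <= M)%N) ->
  exists N (e : 'I_N -> O), orthonormal_basis e V.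
Proof.
move=> Vh Vl Vb; apply: contrapT => Hno.
suff : forall N, exists e : 'I_N -> O, (forall i, V (e i)) /\ orthonormal e.
  by move=> /(_ M.+1)[e [Ve eo]]; have := Vb _ _ Ve eo; rewrite ltnn.
elim=> [|N [e [Ve eo]]]; first by exists (fun=> 0); split=> [[]|[]].
have [x [Vx xe]] : exists x, V x /\ x <> \sum_(i < N) tau (star (e i) * x) *: e i.
  apply: contrapT => H; apply: Hno; exists N, e; split=> // x Vx.
  by apply: contrapT => xe; apply: H; exists x.
exact: (orthonormal_extend Vh Vl Ve eo Vx xe).
Qed.

Lemma finite_dimensional_basis (k : int) (V : set O) :
  (forall y, V y -> homog k y) -> (forall c y z, V y -> V z -> V (c *: y + z)) ->
  finite_dimensional V -> exists N (e : 'I_N -> O), orthonormal_basis e V.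
Proof.
move=> Vh Vl [m [f [Vf fs]]]; apply: (orthonormal_basis_exists (M := m) Vh Vl).
move=> N e Ve eo; have eh i := Vh _ (Ve i); have fh i := Vh _ (Vf i).
pose c i := sval (cid (fs _ (Ve i))).
have cE i : e i = \sum_(j < m) c i j *: f j by rewrite /c; case: cid.
(* The Gram matrix of [e] is the identity of size [N], and expanding [e] in [f] factors it through
   dimension [m]. *)
apply: (@mulmx1_min _ _ _ (\matrix_(i, j) tau (star (e i) * f j)) (\matrix_(j, i) c i j)).
apply/matrixP => i j; rewrite !mxE -[RHS]/((i == j)%:R) -eo [in RHS](cE j) (tau_comb fh) //.
by apply: eq_bigr => l _; rewrite !mxE mulrC.
Qed.

Lemma basis_norm_bound (k : int) (V : set O) N (e : 'I_N -> O) :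
  (forall y, V y -> homog k y) -> orthonormal_basis e V ->
  exists2 C : R, 0 <= C & forall x, V x -> nrm x ^+ 2 <= C * sq x.
Proof.
move=> Vh [Ve eo es]; have eh i := Vh _ (Ve i).
pose B := \sum_(i < N) nrm (e i); have B0 : 0 <= B by rewrite sumr_ge0 // => i _; exact: nrm_ge0.
exists (B ^+ 2); first exact: sqr_ge0.
move=> x Vx; have hx := Vh _ Vx; have s0 := sq_ge0 hn hO hgam hx.
rewrite -(sqr_sqrtr s0) -exprMn lerXn2r ?nnegrE ?nrm_ge0 ?mulr_ge0 ?sqrtr_ge0 //.
rewrite {1}(es _ Vx); apply: le_trans (ler_nrm_sum _ _ _) _.
rewrite mulrC mulr_sumr; apply: ler_sum => i _; rewrite nrmZ ler_wpM2r ?nrm_ge0 //.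
rewrite -[leLHS]ger0_norm ?nrm_ge0 // -sqrtr_sqr ler_wsqrtr //.
apply: le_trans (bessel eh eo hx); rewrite (bigD1 i) //= lerDl.
by rewrite sumr_ge0 // => j _; exact: sqr_ge0.
Qed.

Section Commutant.
Variable B : set O.
Hypotheses (Bh : forall b, B b -> homog 0 b) (Bl : forall c y z, B y -> B z -> B (c *: y + z)).
Hypothesis (Bfin : finite_dimensional B).

(* The trace scales by n^-k between x^* x and x x^*, whose norms agree. *)
Lemma degree_bound : exists K : nat, forall (k : int) x, homog k x ->
  B (star x * x) -> B (x * star x) -> (K < `|k|)%N -> x = 0.
Proof.
have [N [e be]] := finite_dimensional_basis Bh Bl Bfin.
have [C C0 HC] := basis_norm_bound Bh be.
exists (Num.truncn C).
have pos (k : nat) x : homog k x -> B (star x * x) -> B (x * star x) ->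
    (Num.truncn C < k)%N -> x = 0.
  move=> hx hb hb' Ck; apply: contrapT => /eqP/nrm_gt0 nx.
  have h0 := Bh hb; have hxb : homog k (x * (star x * x)).
    by have := homogM hgam hx h0; rewrite addr0.
  (* This is [kms] for [x * (star x * x)] and [x], both of degree [k]. *)
  have sqE : sq (x * star x) = n%:R^-1 ^+ k * sq (star x * x).
    have := kms hn hO hgam hxb hx.
    have -> : star x * (x * (star x * x)) = star (star x * x) * (star x * x).
      by rewrite star_mul starK !mulrA.
    have -> : x * (star x * x) * star x = star (x * star x) * (x * star x).
      by rewrite star_mul starK !mulrA.
    rewrite (tau_sq hn hO hgam (Bh hb)) (tau_sq hn hO hgam (Bh hb')).
    by rewrite -(rmorph_nat (real_complex R)) -fmorphV -rmorphXn -rmorphM /= => /complexI.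
  have n0 : 0 < n%:R :> R by rewrite ltr0n (ltn_trans _ hn).
  have := HC _ hb'; rewrite sqE nrmM_star => H1.
  have := ler_sq hn hO hgam h0; rewrite nrm_starM => H2.
  (* With [HC], [sqE] and [ler_sq]: [|x|^4 <= C sq (x * star x) = C n^-k sq (star x * x) <= C n^-k
     |x|^4]. Since [k < n ^ k], this excludes [k] beyond the integer part of [C]. *)
  have : n%:R ^+ k <= C.
    have x4 : 0 < (nrm x ^+ 2) ^+ 2 by rewrite !exprn_gt0.
    have H3 : (nrm x ^+ 2) ^+ 2 * n%:R ^+ k <= C * (nrm x ^+ 2) ^+ 2.
      rewrite -ler_pdivlMr ?exprn_gt0 // -exprVn; apply: le_trans H1 _.
      rewrite -mulrA; apply: ler_wpM2l => //; rewrite mulrC.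
      by apply: ler_wpM2r => //; rewrite exprn_ge0 // invr_ge0 ltW.
    by rewrite mulrC ler_pM2r in H3.
  rewrite leNgt => /negP; apply; apply: lt_le_trans (truncnS_gt C) _.
  rewrite -natrX ler_nat; apply: leq_trans Ck _.
  by apply: leq_trans (ltnW (ltn_expl k hn)) _.
case=> k x hx hb hb' Kk; first exact: pos hx hb hb' Kk.
have hs : homog k.+1 (star x) by have := homog_star hgam hx; rewrite NegzE opprK.
by rewrite -(starK x) (pos _ _ hs) ?star0 ?starK.
Qed.

(** A double count bounds an orthonormal family [e] of size [N] in [V]. Let [s] be the sum of the
    [e l * star (e l)], and [h] that of the [b j * star (b j)] over an orthonormal basis [b] of [B].
    The KMS relation gives [tau s = q N] and [sq s = q \sum_l \sum_i sq (star (e l) * e i)]. As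
    [star (e l) * e i] is in [B], expanding it in [b] and applying Bessel to [e l * b j] bounds each
    inner sum by [tau (star (e l) * e l * h) <= 8 |h|]. Cauchy-Schwarz against 1 yields
    [(q N)^2 <= q N 8 |h|], so [N <= 8 |h| / q]. *)
Lemma slice_basis (k : int) (V : set O) :
  (forall y, V y -> homog k y) -> (forall c y z, V y -> V z -> V (c *: y + z)) ->
  (forall x y, V x -> V y -> B (star x * y)) ->
  exists N (e : 'I_N -> O), orthonormal_basis e V.
Proof.
move=> Vh Vl VB.
have [d [b [Bb bo bs]]] := finite_dimensional_basis Bh Bl Bfin.
have bh j := Bh (Bb j).
have [q q0 Hq] := kms_int hn hO hgam k.
pose h := \sum_(j < d) b j * star (b j).
have hh : homog 0 h by apply: (homog_sum hgam) => j _; exact: (homogM_star hgam).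
have hs : star h = h.
  by rewrite star_sum; apply: eq_bigr => j _; rewrite star_mul starK.
apply: (orthonormal_basis_exists (M := Num.truncn (8 * nrm h / q)) Vh Vl).
move=> N e Ve eo; have eh i := Vh _ (Ve i).
have e1 l : sq (e l) = 1.
  by apply: (@complexI R); rewrite -(tau_sq hn hO hgam (eh l)) eo eqxx rmorph1.
have row l : \sum_(i < N) sq (star (e l) * e i) <= 8 * nrm h.
  have := tau_order hn hO hgam (eh l) hh hs; rewrite e1 mulr1; apply: le_trans.
  have heb j : homog k (e l * b j) by have := homogM hgam (eh l) (bh j); rewrite addr0.
  have hel := homog_starM hgam (eh l) (eh l).
  have -> : tau (star (e l) * e l * h) = (\sum_(j < d) sq (e l * b j))%:C%C.
    have helb j : homog 0 (star (e l) * e l * b j) by exact: (homog0M hgam).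
    rewrite rmorph_sum /= mulr_sumr (tau_sum hn hO hgam) => [|j _].
      apply: eq_bigr => j _; rewrite -(tau_sq hn hO hgam (heb j)) star_mul mulrA.
      rewrite (tauC hn hO hgam (helb j) (homog0_star hgam (bh j))).
      by rewrite !mulrA.
    by rewrite mulrA; exact: (homog0M hgam (helb j) (homog0_star hgam (bh j))).
  apply: le_trans (_ : \sum_(j < d) \sum_(i < N) nrm (tau (star (e i) * (e l * b j))) ^+ 2 <= _).
    rewrite exchange_big; apply: ler_sum => i _.
    have Bli := VB _ _ (Ve l) (Ve i).
    rewrite [in leLHS](bs _ Bli) (sq_comb bh bo); apply: ler_sum => j _.
    by rewrite (tau_starC hn hO hgam (heb j) (eh i)) nrmcJ star_mul mulrA.
  by rewrite /=; apply: ler_sum => j _; exact: (bessel eh eo (heb j)).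
pose s := \sum_(l < N) e l * star (e l).
have hel l : homog 0 (e l * star (e l)) := homogM_star hgam (eh l) (eh l).
have hss : homog 0 s by exact: (homog_sum hgam).
have s_s : star s = s by rewrite star_sum; apply: eq_bigr => l _; rewrite star_mul starK.
have taus : tau s = (q * N%:R)%:C%C.
  rewrite (tau_sum hn hO hgam) // (eq_bigr (fun=> q%:C%C)) => [|l _].
    by rewrite sumr_const card_ord rmorphM rmorph_nat mulr_natr.
  by rewrite Hq // eo eqxx mulr1.
have sqs : sq s = q * \sum_(l < N) \sum_(i < N) sq (star (e l) * e i).
  apply: (@complexI R); rewrite -(tau_sq hn hO hgam hss) s_s exchange_big.
  have hse i : homog k (s * e i) by have := homogM hgam hss (eh i); rewrite add0r.
  rewrite {2}/s mulr_sumr (tau_sum hn hO hgam) => [|i _]; last exact: (homog0M hgam).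
  rewrite rmorphM rmorph_sum mulr_sumr; apply: eq_bigr => i _.
  rewrite mulrA Hq // /s mulr_suml mulr_sumr (tau_sum hn hO hgam) => [|l _].
    rewrite rmorph_sum /=; congr (_ * _); apply: eq_bigr => l _.
    have hli := homog_starM hgam (eh l) (eh i).
    by rewrite -(tau_sq hn hO hgam hli) star_mul starK !mulrA.
  apply: (homog_starM hgam (eh i)).
  by have := homogM hgam (hel l) (eh i); rewrite add0r.
have := cauchy_schwarz hn hO hgam (homog1 hgam) hss.
have -> : sq 1 = 1 by rewrite /sq star1 mulr1 (tau1 hn hO).
rewrite star1 !mul1r taus nrm_real sqs ger0_norm; last by rewrite mulr_ge0 // ltW.
move=> H; have [N0|N0] := posnP N; first by rewrite N0.
have NR : 0 < N%:R :> R by rewrite ltr0n.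
have h8 : 0 <= 8 * nrm h by rewrite mulr_ge0 // nrm_ge0.
rewrite truncn_ge_nat ?divr_ge0 ?(ltW q0) // ler_pdivlMr //.
have : (q * N%:R) * (N%:R * q) <= (q * N%:R) * (8 * nrm h).
  rewrite (mulrC N%:R q) -expr2; apply: le_trans H _.
  rewrite -mulrA ler_wpM2l ?(ltW q0) //.
  have -> : N%:R * (8 * nrm h) = \sum_(l < N) 8 * nrm h.
    by rewrite sumr_const card_ord mulr_natl.
  by apply: ler_sum => l _; exact: row.
by rewrite ler_pM2l // mulr_gt0.
Qed.

End Commutant.
End OrthonormalBases.

(** * Finiteness of the index *)

(* A family is classifiable when finitely many labels suffice to locate its
   members up to any given precision, i.e. when its range is totally bounded. *)
Definition classifiable (R : realType) (V : normedZmodType R[i]) (G : Type) (f : G -> V) :=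
  forall e : R, 0 < e -> exists (T : finType) (d : G -> T),
    forall g h, d g = d h -> nrm (f g - f h) <= e.

Section Classifiable.
Context {R : realType} {G : Type}.

Lemma classifiable_family (V : normedZmodType R[i]) (I : finType) (f : I -> G -> V) (e : R) :
  (forall i, classifiable (f i)) -> 0 < e ->
  exists (T : finType) (d : G -> T), forall g h, d g = d h ->
    forall i, nrm (f i g - f i h) <= e.
Proof.
move=> fc e0.
suff [T [d dP]] : exists (T : finType) (d : G -> T), forall g h, d g = d h ->
    forall i, i \in enum I -> nrm (f i g - f i h) <= e.
  by exists T, d => g h gh i; apply: dP => //; rewrite mem_enum.
elim: (enum I) => [|i s [T [d dP]]]; first by exists unit, (fun=> tt).
have [T' [d' dP']] := fc i _ e0.
exists (T * T')%type, (fun g => (d g, d' g)) => g h [dd dd'] j.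
by rewrite inE => /orP[/eqP->|js]; [exact: dP'|exact: dP].
Qed.

Lemma classifiable_real (a : G -> R) (C e : R) : (forall g, `|a g| <= C) -> 0 < e ->
  exists (T : finType) (d : G -> T), forall g h, d g = d h -> `|a g - a h| <= e.
Proof.
move=> aC e0; pose q g := (a g + C) / e.
have q0 g : 0 <= q g.
  by rewrite divr_ge0 ?(ltW e0) // -lerBlDr sub0r; have := aC g; rewrite ler_norml => /andP[].
pose N := Num.truncn (2 * C / e).
have qN g : (Num.truncn (q g) < N.+1)%N.
  rewrite ltnS le_truncn // /q ler_pM2r ?invr_gt0 //.
  by have := aC g; rewrite ler_norml => /andP[]; lra.
exists 'I_N.+1, (fun g => Ordinal (qN g)) => g h [E].
have /andP[g1 g2] := truncn_itv (q0 g); have /andP[h1 h2] := truncn_itv (q0 h).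
rewrite E -natr1 in g1 g2; rewrite -natr1 in h2.
have -> : a g - a h = (q g - q h) * e by rewrite /q -mulrBl divfK ?gt_eqF //; lra.
rewrite normrM (gtr0_norm e0) ler_piMl ?(ltW e0) // ler_norml; lra.
Qed.

Lemma classifiable_scalar (f : G -> R[i]) (C : R) :
  (forall g, nrm (f g) <= C) -> classifiable f.
Proof.
move=> fC e e0; have e2 : 0 < e / 2 by rewrite divr_gt0.
have [|T [d dP]] := @classifiable_real (fun g => complex.Re (f g)) C _ _ e2.
  by move=> g; apply: le_trans (ler_Re_nrm _) (fC g).
have [|T' [d' dP']] := @classifiable_real (fun g => complex.Im (f g)) C _ _ e2.
  by move=> g; apply: le_trans (ler_Im_nrm _) (fC g).
exists (T * T')%type, (fun g => (d g, d' g)) => g h [/dP a /dP' b].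
rewrite (splitr e); apply: le_trans (ler_nrm_ReIm _) _.
by rewrite !raddfB; apply: lerD.
Qed.

Lemma classifiable_comb (O : cstarAlgType R) (N : nat) (v : 'I_N -> O) (c : 'I_N -> G -> R[i]) :
  (forall i, classifiable (c i)) -> classifiable (fun g => \sum_(i < N) c i g *: v i).
Proof.
move=> cc e e0; pose B := \sum_(i < N) nrm (v i) + 1.
have B0 : 0 < B by rewrite ltr_wpDl // sumr_ge0 // => i _; exact: nrm_ge0.
have [T [d dP]] := classifiable_family cc (divr_gt0 e0 B0).
exists T, d => g h /dP H; rewrite -sumrB; apply: le_trans (ler_nrm_sum _ _ _) _.
apply: le_trans (_ : \sum_(i < N) e / B * nrm (v i) <= _).
  by apply: ler_sum => i _; rewrite -scalerBl nrmZ ler_wpM2r ?nrm_ge0.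
by rewrite -mulr_sumr mulrAC ler_pdivrMr // ler_wpM2l ?(ltW e0) // lerDl.
Qed.

End Classifiable.

(** * Normalizers and the automorphisms they induce *)

Section Normalizers.
Context {R : realType} {O : cstarAlgType R}.
Implicit Types (x y a u : O).

Section Subgroup.
Variables (C : set O) (A : cstarSub O).
Hypotheses (C1 : C 1) (CM : forall x y, C x -> C y -> C (x * y)) (CS : forall x, C x -> C (star x)).

Lemma normalizer_conj u a : normalizer C A u -> csub_set A a -> csub_set A (u * a * star u).
Proof. by move=> [_ uA _ _] Aa; rewrite -uA; exists a. Qed.

Lemma normalizer_conjV u a : normalizer C A u -> csub_set A a -> csub_set A (star u * a * u).
Proof.
move=> [_ uA _ uu]; rewrite -{1}uA => -[b Ab <-].
by rewrite !mulrA uu mul1r -mulrA uu mulr1.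
Qed.

Lemma conjK u a : normalizer C A u -> star u * (u * a * star u) * u = a.
Proof. by move=> [_ _ _ uu]; rewrite !mulrA uu mul1r -mulrA uu mulr1. Qed.

Lemma conjVK u a : normalizer C A u -> u * (star u * a * u) * star u = a.
Proof. by move=> [_ _ uu _]; rewrite !mulrA uu mul1r -mulrA uu mulr1. Qed.

Lemma normalizerV u : normalizer C A u -> normalizer C A (star u).
Proof.
move=> nu; have [Cu _ uu uu'] := nu; split; rewrite ?starK //; first exact: CS.
apply/seteqP; split=> [_ [a Aa <-]|a Aa]; first exact: normalizer_conjV nu Aa.
by exists (u * a * star u); [exact: normalizer_conj nu Aa|exact: conjK nu].
Qed.

Lemma normalizerM u v : normalizer C A u -> normalizer C A v -> normalizer C A (u * v).
Proof.
move=> nu nv; have [Cu _ uu uu'] := nu; have [Cv _ vv vv'] := nv.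
have E a : u * v * a * star (u * v) = u * (v * a * star v) * star u.
  by rewrite star_mul !mulrA.
split; first exact: CM.
- apply/seteqP; split=> [_ [a Aa <-]|a Aa].
    by rewrite E; apply: (normalizer_conj nu); exact: normalizer_conj nv Aa.
  exists (star v * (star u * a * u) * v); last by rewrite E (conjVK _ nv) (conjVK _ nu).
  by apply: (normalizer_conjV nv); exact: normalizer_conjV nu Aa.
- by rewrite star_mul mulrA -(mulrA u) vv mulr1.
- by rewrite star_mul mulrA -(mulrA (star v)) uu' mulr1.
Qed.

Lemma aut_conjV (g : Aut A) u : normalizer C A u ->
  (forall a : A, \val (g a) = u * \val a * star u) ->
  forall a : A, \val ((g^-1)%g a) = star u * \val a * u.
Proof.
move=> nu gu a; have ga : g ((g^-1)%g a) = a.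
  by rewrite -[LHS]/((g * g^-1)%g a) mulgV.
by rewrite -{2}ga gu (conjK _ nu).
Qed.

Lemma Ad_restrictions_subgroup : is_subgroup (Ad_restrictions C A).
Proof.
split.
- exists 1 => [|a]; last by rewrite star1 mul1r mulr1.
  split; rewrite ?star1 ?mulr1 //; apply/seteqP; split=> [_ [a Aa <-]|a Aa].
    by rewrite mul1r mulr1.
  by exists a; rewrite // mul1r mulr1.
- move=> g h [u nu gu] [v nv hv]; exists (u * v); first exact: normalizerM.
  by move=> a; rewrite -[LHS]/(\val (g (h a))) gu hv star_mul !mulrA.
- move=> g [u nu gu]; exists (star u); first exact: normalizerV.
  by move=> a; rewrite starK; exact: aut_conjV nu gu a.
Qed.

End Subgroup.
End Normalizers.

Lemma finite_left_cosets (T : groupType) (H G : set T) (L : finType) (d : T -> L) :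
  is_subgroup H -> (forall g h, G g -> G h -> d g = d h -> H (h^-1 * g)%g) ->
  finite_set (left_cosets H G).
Proof.
move=> [_ HM HV] dH.
pose c l := [set (g * h)%g | g in [set g | G g /\ d g = l] & h in H].
have cE g : G g -> [set (g * h)%g | h in H] = c (d g).
  move=> Gg; apply/seteqP; split=> [_ [h Hh <-]|x [g' [Gg' dg'] [h Hh <-]]].
    by exists g => //; exists h.
  exists (g^-1 * g' * h)%g; last by rewrite !mulgA mulgV mul1g.
  by apply: HM => //; exact: dH.
apply: (@sub_finite_set _ _ (range c)); last exact/finite_image/finite_finset.
by move=> _ [g Gg <-]; exists (d g); rewrite // cE.
Qed.

(** * Fourier coefficients of normalizing unitaries *)

Section Index.
Context {R : realType} {O : cstarAlgType R} (n : nat) (S : 'I_n -> O).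
Context (gam : R[i] -> O -> O) (A : cstarSub O).
Hypotheses (hO : is_cuntz_algebra S) (hgam : is_gauge_action S gam).
Hypothesis hA : A `<=` gauge_fixed gam.
Implicit Types (x y a u : O) (k l : int).
Local Notation homog := (homog gam).
Local Notation tau := (tau S).
Local Notation B := (relative_commutant (gauge_fixed gam) A).
Local Notation fcoef := (fcoef hO hgam).

Lemma homog_sub a : csub_set A a -> homog 0 a.
Proof. by move=> /hA; rewrite -homog_fixed. Qed.

Lemma commutant_homog x : B x -> homog 0 x.
Proof. by rewrite homog_fixed => -[]. Qed.

Lemma commutant_lin c x y : B x -> B y -> B (c *: x + y).
Proof.
move=> [hx cx] [hy cy]; split.
  move: hx hy; rewrite -homog_fixed => hx hy.
  by apply: (homogD hgam) => //; exact: (homogZ hgam).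
by move=> a Aa; rewrite mulrDl mulrDr -scalerAl -scalerAr cx // cy.
Qed.

Section Unitary.
Variable u : O.
Hypothesis nu : normalizer setT A u.

Lemma fcoef_twist k a : csub_set A a -> fcoef k u * a = (u * a * star u) * fcoef k u.
Proof.
move=> Aa; have [_ _ _ uu] := nu.
have hb := homog_sub (normalizer_conj nu Aa).
have := fcoefMr hO hgam k u (homog_sub Aa).
have := fcoefMl hO hgam k u hb; rewrite -mulrA uu mulr1 subr0 => -> ->.
by [].
Qed.

Lemma fcoef_twist_star k a : csub_set A a ->
  a * star (fcoef k u) = star (fcoef k u) * (u * a * star u).
Proof.
move=> Aa; have := fcoef_twist k (csubS Aa) => /(congr1 star).
by rewrite !star_mul !starK !mulrA.
Qed.

Lemma fcoef_starM_commute k l a : csub_set A a ->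
  star (fcoef k u) * fcoef l u * a = a * (star (fcoef k u) * fcoef l u).
Proof.
by move=> Aa; rewrite -mulrA fcoef_twist // mulrA -(fcoef_twist_star k Aa) mulrA.
Qed.

Lemma fcoefM_star_commute k l a : csub_set A a ->
  fcoef k u * star (fcoef l u) * a = a * (fcoef k u * star (fcoef l u)).
Proof.
(* The twist relations give commutation with the elements [u * b * star u]; as [u] normalizes [A],
   these are all of [A]. *)
move=> Aa; have [b Ab ->] : exists2 b, csub_set A b & a = u * b * star u.
  by exists (star u * a * u); [exact: normalizer_conjV nu Aa|rewrite (conjVK _ nu)].
by rewrite -mulrA -(fcoef_twist_star l Ab) mulrA fcoef_twist // -mulrA.
Qed.

Lemma unitary_nrm : nrm u = 1.
Proof.
have [_ _ _ uu] := nu.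
apply/eqP; rewrite -(@eqrXn2 _ 2) ?nrm_ge0 // -nrm_starM uu nrm1.
by rewrite expr1n.
Qed.

Lemma nrm_fcoef_unitary k : nrm (fcoef k u) <= 2.
Proof.
by apply: le_trans (nrm_fcoef hO hgam _ _) _; rewrite unitary_nrm mulr1.
Qed.

Lemma fcoef_commutant k : B (star (fcoef k u) * fcoef k u) /\ B (fcoef k u * star (fcoef k u)).
Proof.
have hk := homog_fcoef hO hgam k u.
split; split; rewrite -?homog_fixed.
- exact: (homog_starM hgam hk hk).
- by move=> a Aa; exact: fcoef_starM_commute.
- exact: (homogM_star hgam hk hk).
- by move=> a Aa; exact: fcoefM_star_commute.
Qed.

(** A Parseval identity. By [D0], [u] and its partial sum over the degrees from [-K] to [K] have the
    same coefficients, so [fcoef_eq0] lets the partial sum replace the right factor in the degree 0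
    coefficient of [star u * u = 1]. The index [i] stands for the degree [i - K]. *)
Lemma sum_fcoef (K : nat) : (forall k, (K < `|k|)%N -> fcoef k u = 0) ->
  \sum_(i < (2 * K).+1) star (fcoef (i%:Z - K%:Z) u) * fcoef (i%:Z - K%:Z) u = 1.
Proof.
move=> hK; pose kk (i : 'I_(2 * K).+1) := i%:Z - K%:Z.
have D0 k : fcoef k (u - \sum_i fcoef (kk i) u) = 0.
  rewrite fcoefB fcoef_sum.
  under eq_bigr do rewrite (fcoef_homog hO hgam k (homog_fcoef hO hgam _ _)).
  have [Kk|kK] := ltnP K `|k|.
    rewrite hK // big1 ?subrr // => i _; case: eqP => [ik|_]; last by rewrite mulr0n.
    by rewrite ik hK // mul0rn.
  have iP : (`|(k + K%:Z)%R| < (2 * K).+1)%N by lia.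
  rewrite (bigD1 (Ordinal iP)) //= big1 ?addr0 => [|i ik].
    have -> : kk (Ordinal iP) = k by rewrite /kk /=; lia.
    by rewrite eqxx subrr.
  case: eqP => [E|]; last by rewrite mulr0n.
  by case/eqP: ik; apply: val_inj => /=; move: E; rewrite /kk; lia.
have [_ _ _ uu] := nu.
have := fcoef_eq0 (star u) D0; rewrite mulrBr fcoefB uu mulr_sumr fcoef_sum.
rewrite (fcoef_homog hO hgam 0 (homog1 hgam)) eqxx mulr1n => /eqP; rewrite subr_eq0 => /eqP ->.
apply: eq_bigr => i _; rewrite (fcoefMr hO hgam 0 _ (homog_fcoef hO hgam _ _)).
by rewrite sub0r fcoef_star opprK.
Qed.

End Unitary.

Hypothesis hn : (2 <= n)%N.
Hypothesis hfin : finite_dimensional (relative_commutant (gauge_fixed gam) A).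

Lemma fcoef_degree_bound : exists K : nat, forall u k, normalizer setT A u ->
  (K < `|k|)%N -> fcoef k u = 0.
Proof.
have [K HK] := degree_bound hn hO hgam commutant_homog commutant_lin hfin.
exists K => u k nu; have [h1 h2] := fcoef_commutant nu k.
exact: HK (homog_fcoef hO hgam k u) h1 h2.
Qed.

(** The space [V] does not depend on the unitary, so only coordinates in a fixed finite basis vary.
    They are bounded by [4 |e i|], each of the two coefficients having norm at most 2. *)
Lemma fcoefM_star_classifiable k l :
  classifiable (fun u : {u : O | normalizer setT A u} =>
    fcoef k (sval u) * star (fcoef l (sval u))).
Proof.
pose V : set O := [set x | homog (k - l) x /\ forall a, csub_set A a -> x * a = a * x].
have [x [hx _] //|c x y [hx cx] [hy cy]|x y [hx cx] [hy cy]|N [e [Ve eo es]]] :=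
  slice_basis hn hO hgam commutant_homog commutant_lin hfin (k := k - l) (V := V).
- split; first by apply: (homogD hgam) => //; exact: (homogZ hgam).
  by move=> a Aa; rewrite mulrDl mulrDr -scalerAl -scalerAr cx // cy.
- split; first by rewrite -homog_fixed; exact: (homog_starM hgam hx hy).
  move=> a Aa; rewrite -mulrA cy // !mulrA; congr (_ * _).
  by have := cx _ (csubS Aa) => /(congr1 star); rewrite !star_mul starK.
have Vu (u : {u : O | normalizer setT A u}) : V (fcoef k (sval u) * star (fcoef l (sval u))).
  split; last by move=> a Aa; exact: (fcoefM_star_commute (svalP u)).
  exact: (homogM hgam (homog_fcoef hO hgam k _) (homog_star hgam (homog_fcoef hO hgam l _))).
pose c i (u : {u : O | normalizer setT A u}) :=
  tau (star (e i) * (fcoef k (sval u) * star (fcoef l (sval u)))).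
have cc i : classifiable (c i).
  apply: (@classifiable_scalar _ _ _ (nrm (e i) * 4)) => u.
  have [hv _] := Vu u; have [he _] := Ve i.
  apply: le_trans (nrm_tau hn hO hgam (homog_starM hgam he hv)) _.
  apply: le_trans (nrmM _ _) _; rewrite nrm_star ler_wpM2l ?nrm_ge0 //.
  apply: le_trans (nrmM _ _) _; rewrite nrm_star.
  have := nrm_fcoef_unitary (svalP u) k; have := nrm_fcoef_unitary (svalP u) l.
  have := nrm_ge0 (fcoef k (sval u)); have := nrm_ge0 (fcoef l (sval u)); nra.
move=> e' e0; have [T [d dP]] := classifiable_comb e cc e0.
exists T, d => g h /dP; rewrite -!es //; exact: Vu.
Qed.

End Index.

(** * Near-isometries and their unitary parts *)

Section Approximate.
Context {R : realType} {O : cstarAlgType R} (I : finType).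
Implicit Types (f g : I -> O).

(* sum_i f_i^* g_i is then almost isometric: replacing g_i g_j^* by f_i f_j^*
   turns its square into (sum_i f_i^* f_i)^2 = 1. *)
Lemma near_isometry f g :
  (forall i, nrm (f i) <= 2) -> \sum_i star (f i) * f i = 1 ->
  (forall i j, nrm (f i * star (f j) - g i * star (g j)) <= (32 * #|I|%:R ^+ 2)^-1) ->
  nrm (1 - (\sum_i star (f i) * g i) * star (\sum_i star (f i) * g i)) <= 8^-1.
Proof.
move=> f2 f1 fg; set x := \sum_i _.
have -> : 1 - x * star x =
    \sum_i \sum_j star (f i) * (f i * star (f j) - g i * star (g j)) * f j.
  have -> : 1 = \sum_i \sum_j star (f i) * (f i * star (f j)) * f j :> O.
    rewrite -{1}[1]mulr1 -{1}f1 -f1 mulr_suml; apply: eq_bigr => i _.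
    by rewrite mulr_sumr; apply: eq_bigr => j _; rewrite !mulrA.
  have -> : x * star x = \sum_i \sum_j star (f i) * (g i * star (g j)) * f j.
    rewrite /x mulr_suml; apply: eq_bigr => i _; rewrite star_sum mulr_sumr.
    by apply: eq_bigr => j _; rewrite star_mul starK !mulrA.
  rewrite -sumrB; apply: eq_bigr => i _; rewrite -sumrB; apply: eq_bigr => j _.
  by rewrite mulrBr mulrBl.
have [I0|I0] := posnP #|I|.
  rewrite big1 ?nrm0 ?invr_ge0 // => i _.
  by have := card0_eq I0 i; rewrite inE.
have N0 : 0 < #|I|%:R :> R by rewrite ltr0n.
have e0 : 0 < (32 * #|I|%:R ^+ 2)^-1 :> R by rewrite invr_gt0 mulr_gt0 // exprn_gt0.
apply: le_trans (ler_nrm_sum _ _ _) _.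
(* Each of the [#|I| ^ 2] terms is at most [2 * 2] times the precision, so the factor 32 produces
   the 1/8 that [isqrt_exists] accepts. *)
apply: le_trans (_ : \sum_(i : I) \sum_(j : I) 4 * (32 * #|I|%:R ^+ 2)^-1 <= _).
  apply: ler_sum => i _; apply: le_trans (ler_nrm_sum _ _ _) _; apply: ler_sum => j _.
  set z := _ - _; have := fg i j; rewrite -/z; have := f2 i; have := f2 j.
  have := nrmM (star (f i) * z) (f j); have := nrmM (star (f i)) z; rewrite nrm_star.
  have := nrm_ge0 z; have := nrm_ge0 (f i); have := nrm_ge0 (f j).
  have := nrm_ge0 (star (f i) * z).
  move: (_^-1) e0 => e e0 h1 h2 h3 h4 h5 h6 h7 h8 h9.
  have k1 : nrm (f i) * nrm z <= 2 * e by apply: ler_pM.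
  have k2 : nrm (star (f i) * z) * nrm (f j) <= (2 * e) * 2.
    by apply: ler_pM => //; apply: le_trans h5 k1.
  lra.
rewrite !sumr_const -mulrnA -[leLHS]mulr_natl natrM.
rewrite [leLHS](_ : _ = 8^-1) //; field; rewrite gt_eqF //.
Qed.

End Approximate.

Section Polar.
Context {R : realType} {O : cstarAlgType R} (n : nat) (S : 'I_n -> O).
Context (gam : R[i] -> O -> O) (A : cstarSub O).
Hypothesis hgam : is_gauge_action S gam.
Implicit Types (x y a u : O).

(* The unitary part x (x^* x)^(-1/2) of an almost unitary intertwiner. *)
Lemma polar_intertwiner x (f : O -> O) :
  gauge_fixed gam x -> nrm (1 - star x * x) <= 8^-1 -> nrm (1 - x * star x) <= 8^-1 ->
  (forall a, csub_set A a -> x * a = f a * x) ->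
  (forall a, csub_set A a -> star (f a) = f (star a)) ->
  exists u, [/\ gauge_fixed gam u, u * star u = 1, star u * u = 1 &
    forall a, csub_set A a -> u * a = f a * u].
Proof.
rewrite -homog_fixed => hx x8 x8' xf fs; pose d := 1 - star x * x.
have hd : homog gam 0 d.
  by apply: (homogB hgam (homog1 hgam)); exact: (homog_starM hgam hx hx).
have ds : star d = d by rewrite starB star1 star_mul starK.
have dA a : csub_set A a -> d * a = a * d.
  move=> Aa; rewrite mulrBl mulrBr mul1r mulr1 -mulrA xf // !mulrA.
  have := xf _ (csubS Aa) => /(congr1 star); rewrite !star_mul starK fs ?starK //.
    by move=> ->.
  exact: csubS.
(* Commutation of [t] with [A] keeps [x * t] an intertwiner; commutation with [d] makes it an
   isometry. *)
pose Q a := csub_set A a \/ a = d.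
pose Z : set O := [set y | homog gam 0 y /\ star y = y] `&`
  [set y | forall a, Q a -> y * a = a * y].
have dQ a : Q a -> d * a = a * d by case=> [|->] //; exact: dA.
have [||y Zy|y [[hy ys] yQ] yE] := @isqrt_exists _ _ d Z x8.
- move=> u l uZ ul; split; last by apply: tclosed_commutant ul => m; case: (uZ m).
  split; last by apply: tclosed_self ul => m; case: (uZ m) => -[].
  by apply: (tclosed_homog hgam) ul => m; case: (uZ m) => -[].
- split; last by move=> a _; rewrite mul0r mulr0.
  by split; [exact: (homog0 hgam)|exact: star0].
- case: Zy => -[hy ys] yQ; have yd := yQ d (or_intror erefl); split; last first.
    by move=> a Qa; apply: comm_isqrt_step; [exact: yQ|exact: dQ].
  split; last exact: star_isqrt_step.
  apply: (homogZ hgam); apply: (homogB hgam); last exact: (homog0M hgam).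
  apply: (homogD hgam); last exact: (homog0M hgam (homog0M hgam hy hy) hd).
  by apply: (homogD hgam) => //; apply: (homog0M hgam) => //; apply: (homogD hgam).
pose t := 1 + y; have ts : star t = t by rewrite starD star1 ys.
have ht : homog gam 0 t by apply: (homogD hgam (homog1 hgam)).
have tQ a : Q a -> t * a = a * t by move=> Qa; exact/comm_1D/yQ.
have xx : star x * x = 1 - d by rewrite opprB addrC subrK.
have td := comm_1B (tQ d (or_intror erefl)).
have ttx : t * t * (star x * x) = 1 by rewrite xx.
exists (x * t); split.
- exact: (homog0M hgam).
(* An isometry need not be unitary. The second smallness bound provides a right inverse [v] of
   [x * star x], and inserting [x * star x * v = 1] after [x t t x^*] reduces that product to 1. *)
- pose d' := 1 - x * star x; pose Z' : set O := [set y | forall a, [set d'] a -> y * a = a * y].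
  have [||w Zw|w wd wE] := @isqrt_exists _ _ d' Z' x8'.
  + exact: tclosed_commutant.
  + by move=> a _; rewrite mul0r mulr0.
  + by move=> _ ->; apply: comm_isqrt_step => //; exact: Zw.
  have {}wd := wd _ erefl.
  have wd1 : (1 + w) * (1 - d') = (1 - d') * (1 + w).
    exact/comm_1B/comm_1D.
  have xx' : x * star x = 1 - d' by rewrite opprB addrC subrK.
  have inv : x * star x * ((1 + w) * (1 + w)) = 1.
    by rewrite xx' mulrA -wd1 -mulrA -wd1 mulrA wE.
  pose v := (1 + w) * (1 + w); rewrite star_mul ts -[LHS]mulr1 -[X in _ * X]inv -/v.
  have -> : x * t * (t * star x) * (x * star x * v) = x * (t * t * (star x * x)) * star x * v.
    by rewrite !mulrA.
  by rewrite ttx mulr1 inv.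
- rewrite star_mul ts; have -> : t * star x * (x * t) = t * (star x * x) * t by rewrite !mulrA.
  by rewrite xx -mulrA -td mulrA.
- by move=> a Aa; rewrite -mulrA tQ; [rewrite mulrA xf // mulrA|left].
Qed.

End Polar.

Theorem theorem2p2 (R : realType) (O : cstarAlgType R) (n : nat)
  (hn : (2 <= n)%N) (S : 'I_n -> O) (hO : is_cuntz_algebra S)
  (gam : R[i] -> O -> O) (hgam : is_gauge_action S gam)
  (A : cstarSub O) (hA : A `<=` gauge_fixed gam)
  (hfin : finite_dimensional (relative_commutant (gauge_fixed gam) A)) :
  let G := Ad_restrictions setT A in
  let H := Ad_restrictions (gauge_fixed gam) A in
  [/\ is_subgroup G, is_subgroup H, H `<=` G & finite_set (left_cosets H G)].
Proof.
move=> G H.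
have Gs : is_subgroup G by exact: Ad_restrictions_subgroup.
have Hs : is_subgroup H.
  apply: Ad_restrictions_subgroup; rewrite -homog_fixed.
  - exact: (homog1 hgam).
  - by move=> x y; exact: (homog0M hgam).
  - by move=> x; exact: (homog0_star hgam).
split=> //; first by move=> g [u [_ uA uu uu'] gu]; exists u.
pose N := {u : O | normalizer setT A u}.
have [K HK] := fcoef_degree_bound hO hgam hA hn hfin.
pose I := 'I_(2 * K).+1.
pose F (i : I) u := fcoef hO hgam (i%:Z - K%:Z) u.
have F2 (i : I) (u : N) : nrm (F i (sval u)) <= 2 := nrm_fcoef_unitary hO hgam (svalP u) _.
have F1 (u : N) : \sum_i star (F i (sval u)) * F i (sval u) = 1.
  have nu : normalizer setT A (sval u) := svalP u.
  by have := sum_fcoef nu (fun k => HK _ k nu).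
have e0 : 0 < (32 * #|{: I}|%:R ^+ 2)^-1 :> R.
  by rewrite invr_gt0 mulr_gt0 // exprn_gt0 // ltr0n card_ord.
have Fc (p : I * I) : classifiable (fun u : N => F p.1 (sval u) * star (F p.2 (sval u))).
  exact: (fcoefM_star_classifiable hO hgam hA hn hfin).
have [T [d dP]] := classifiable_family Fc e0.
(* Outside of [G] the representative is an arbitrary normalizing unitary, taken from the identity of
   [G]. *)
have repr g : exists u : N, G g -> forall a : A, \val (g a) = sval u * \val a * star (sval u).
  have [[u nu gu]|ng] := pselect (G g); first by exists (exist _ u nu).
  have [[u nu _] _ _] := Gs; by exists (exist _ u nu).
pose U g := sval (cid (repr g)).
have UP g : G g -> forall a : A, \val (g a) = sval (U g) * \val a * star (sval (U g)).
  by rewrite /U; case: cid.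
apply: (@finite_left_cosets _ _ _ T (d \o U)) => // g h Gg Gh /= /dP Ugh.
set u := U g in Ugh; set w := U h in Ugh.
have nu := svalP u; have nw := svalP w.
pose x := \sum_i star (F i (sval w)) * F i (sval u).
pose f a := star (sval w) * (sval u * a * star (sval u)) * sval w.
have xs : star x = \sum_i star (F i (sval u)) * F i (sval w).
  by rewrite star_sum; apply: eq_bigr => i _; rewrite star_mul starK.
(* Closeness of the two arrays is symmetric, and exchanging [u] and [w] exchanges [x] and [star x];
   both one-sided estimates follow from [near_isometry]. *)
have x1 : nrm (1 - x * star x) <= 8^-1.
  apply: near_isometry => // i j; rewrite nrmBC.
  exact: (Ugh (i, j)).
have x2 : nrm (1 - star x * x) <= 8^-1.
  rewrite -{2}(starK x) xs; apply: near_isometry => // i j.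
  exact: (Ugh (i, j)).
have hx : gauge_fixed gam x.
  rewrite -homog_fixed; apply: (homog_sum hgam) => i _.
  by apply: (homog_starM hgam); exact: homog_fcoef.
have xf a : csub_set A a -> x * a = f a * x.
  move=> Aa; rewrite mulr_suml mulr_sumr; apply: eq_bigr => i _.
  have Ab := normalizer_conj nu Aa; have Ac := normalizer_conjV nw Ab.
  rewrite -mulrA (fcoef_twist hO hgam hA nu) // mulrA.
  have := fcoef_twist_star hO hgam hA nw (i%:Z - K%:Z) Ac; rewrite (conjVK _ nw) => <-.
  by rewrite -mulrA.
have fs a : csub_set A a -> star (f a) = f (star a).
  by move=> _; rewrite /f !star_mul !starK !mulrA.
have [v [Fv vv vv' vf]] := polar_intertwiner hgam hx x2 x1 xf fs.
have vE a : csub_set A a -> v * a * star v = f a.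
  by move=> Aa; rewrite vf // -mulrA vv mulr1.
exists v; first split=> //.
  apply/seteqP; split=> [_ [a Aa <-]|b Ab].
    by rewrite vE //; apply: (normalizer_conjV nw); exact: normalizer_conj nu Aa.
  have Ac := normalizer_conjV nu (normalizer_conj nw Ab).
  exists (star (sval u) * (sval w * b * star (sval w)) * sval u) => //.
  by rewrite vE // /f (conjVK _ nu) (conjK _ nw).
move=> a; rewrite vE; last exact: set_valP.
rewrite -[LHS]/(\val ((h^-1)%g (g a))).
by rewrite (aut_conjV nw (UP _ Gh)) (UP _ Gg).
Qed.
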